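(* Let $G$ be a Polish groupoid. Every Borel $G$-space is Borel $G$-isomorphic to a Polish $G$-space. Equivalently, if $X$ is a Borel $G$-space, then there is a Polish topology on $X$ generating the Borel structure of $X$ with respect to which the anchor map and the action of $G$ on $X$ are continuous.
   Context: A groupoid is a small category in which every arrow is invertible; $G^0$ objects (identified with identity arrows), $s,r$ source and range. A topological space is locally Polish if it has a countable basis of open sets Polish in the relative topology. A Polish groupoid is a groupoid with a locally Polish topology such that composition and inversion are continuous and open, $G^0$ is Polish in the subspace topology, and $Gx=s^{-1}(x)$, $xG=r^{-1}(x)$ are Polish in the subspace topology for all $x\in G^0$. A Borel $G$-space is a standard Borel space $X$ with a Borel anchor map $p:X\to G^0$ and a Borel map $(\gamma,x)\mapsto \gamma x$ on $G\ltimes X=\{(\gamma,x)\in G\times X:s(\gamma)=p(x)\}$ such that $\gamma(\rho x)=(\gamma\rho)x$, $p(\gamma x)=r(\gamma)$ and $p(x)x=x$. A Polish $G$-space is a Polish space $X$ with such data where $p$ and the action map are continuous. A Borel $G$-isomorphism from $X$ to $Y$ is a Borel bijection $\varphi$ with $p_Y\circ\varphi=p_X$ and $\varphi(\gamma x)=\gamma\varphi(x)$. *)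

(* Defs.v *)
From HB Require Import structures.
From mathcomp Require Import all_boot all_order all_algebra.
From mathcomp Require Import all_classical all_reals all_analysis.

Set Implicit Arguments.
Unset Strict Implicit.
Unset Printing Implicit Defensive.

Local Open Scope classical_set_scope.

(* A [measurableType] is pointed, which would exclude empty spaces; Borel
   structures are therefore given by plain set systems on possibly empty types.
   A subset [A] of a space carries the subspace topology of [set_type A]. *)

(** * Polish and standard Borel spaces *)

Definition completely_metrizable (R : realType) (T : topologicalType) : Prop :=
  exists m : Metric R T,
    let M : metricType R := Metric.Pack m in
    (@open M = @open T) /\
    (forall F : set_system M, ProperFilter F -> cauchy F ->
       exists l : M, F --> l).

Definition separable (T : topologicalType) : Prop :=
  exists2 D : set T, countable D & dense D.

Definition polish (R : realType) (T : topologicalType) : Prop :=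
  completely_metrizable R T /\ separable T.

Definition locally_polish (R : realType) (T : topologicalType) : Prop :=
  exists B : set (set T),
    [/\ countable B, basis B & forall U, B U -> polish R (set_type U)].

Definition borel (T : topologicalType) : set (set T) := <<s @open T >>.
Arguments borel T : clear implicits.

Definition borel_map (X Y : Type) (SX : set (set X)) (SY : set (set Y))
    (f : X -> Y) : Prop :=
  forall B, SY B -> SX (f @^-1` B).

Definition prod_borel (X Y : Type) (SX : set (set X)) (SY : set (set Y)) :
    set (set (X * Y)) :=
  <<s preimage_set_system setT fst SX `|` preimage_set_system setT snd SY >>.

Definition sub_borel (X : Type) (SX : set (set X)) (A : set X) :
    set (set (set_type A)) :=
  preimage_set_system setT set_val SX.

Definition standard_borel (R : realType) (X : Type) (S : set (set X)) : Prop :=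
  exists t : Topological X,
    let T : topologicalType := Topological.Pack t in
    polish R T /\ borel T = S.

Definition open_map (S T : topologicalType) (f : S -> T) : Prop :=
  forall U : set S, open U -> open (f @` U).

(** * Groupoids *)

(* The type of arrows [G] contains the objects as identity arrows. The product
   [gmul g h] is only meaningful when [src g = rng h]. *)
Record groupoid (G : Type) := Groupoid {
  src : G -> G;
  rng : G -> G;
  gmul : G -> G -> G;
  ginv : G -> G;
  src_src : forall g, src (src g) = src g;
  rng_src : forall g, rng (src g) = src g;
  src_rng : forall g, src (rng g) = rng g;
  rng_rng : forall g, rng (rng g) = rng g;
  src_gmul : forall g h, src g = rng h -> src (gmul g h) = src h;
  rng_gmul : forall g h, src g = rng h -> rng (gmul g h) = rng g;
  gmulA : forall g h k, src g = rng h -> src h = rng k ->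
    gmul g (gmul h k) = gmul (gmul g h) k;
  gmul_src : forall g, gmul g (src g) = g;
  gmul_rng : forall g, gmul (rng g) g = g;
  src_ginv : forall g, src (ginv g) = rng g;
  rng_ginv : forall g, rng (ginv g) = src g;
  gmulVg : forall g, gmul (ginv g) g = src g;
  gmulgV : forall g, gmul g (ginv g) = rng g
}.

Definition units (G : Type) (gpd : groupoid G) : set G :=
  [set x | src gpd x = x].

Definition composable (G : Type) (gpd : groupoid G) : set (G * G) :=
  [set gh | src gpd gh.1 = rng gpd gh.2].

Definition composition (G : Type) (gpd : groupoid G)
    (gh : set_type (composable gpd)) : G :=
  gmul gpd (set_val gh).1 (set_val gh).2.

Record polish_groupoid (R : realType) (G : topologicalType)
    (gpd : groupoid G) : Prop := PolishGroupoid {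
  pg_locally_polish : locally_polish R G;
  pg_mul_continuous : continuous (composition (gpd := gpd));
  pg_mul_open : open_map (composition (gpd := gpd));
  pg_inv_continuous : continuous (ginv gpd);
  pg_inv_open : open_map (ginv gpd);
  pg_units_polish : polish R (set_type (units gpd));
  pg_src_polish : forall x, units gpd x ->
    polish R (set_type [set g | src gpd g = x]);
  pg_rng_polish : forall x, units gpd x ->
    polish R (set_type [set g | rng gpd g = x])
}.

(** * Spaces with a groupoid action *)

(* [act g x] is only meaningful when [src g] is the anchor of [x]. *)
Record gspace (G : Type) (gpd : groupoid G) (X : Type) := GSpace {
  anchor : X -> set_type (units gpd);
  act : G -> X -> X;
  anchor_act : forall g x, src gpd g = set_val (anchor x) ->
    set_val (anchor (act g x)) = rng gpd g;
  act_gmul : forall g h x, src gpd g = rng gpd h ->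
    src gpd h = set_val (anchor x) -> act g (act h x) = act (gmul gpd g h) x;
  act_anchor : forall x, act (set_val (anchor x)) x = x
}.

Definition fibre_product (G : Type) (gpd : groupoid G) (X : Type)
    (a : gspace gpd X) : set (G * X) :=
  [set gx | src gpd gx.1 = set_val (anchor a gx.2)].

Definition action (G : Type) (gpd : groupoid G) (X : Type)
    (a : gspace gpd X) (gx : set_type (fibre_product a)) : X :=
  act a (set_val gx).1 (set_val gx).2.

Definition borel_gspace (R : realType) (G : topologicalType)
    (gpd : groupoid G) (X : Type) (S : set (set X)) (a : gspace gpd X) : Prop :=
  [/\ standard_borel R S,
      borel_map S (borel (set_type (units gpd))) (anchor a) &
      borel_map (sub_borel (prod_borel (borel G) S) (A := fibre_product a)) S
        (action (a := a))].

Definition polish_gspace (R : realType) (G : topologicalType)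
    (gpd : groupoid G) (X : topologicalType) (a : gspace gpd X) : Prop :=
  [/\ polish R X, continuous (anchor a) & continuous (action (a := a))].

Definition borel_gisomorphism (G : Type) (gpd : groupoid G)
    (X Y : Type) (SX : set (set X)) (SY : set (set Y))
    (aX : gspace gpd X) (aY : gspace gpd Y) (phi : X -> Y) : Prop :=
  [/\ bijective phi, borel_map SX SY phi,
      forall x, anchor aY (phi x) = anchor aX x &
      forall g x, src gpd g = set_val (anchor aX x) ->
        phi (act aX g x) = act aY g (phi x)].

(* Main.v *)
(* Becker-Kechris topologization, with a metric-free notion of completeness.

   For a Borel set [A] of [X] and an open set [V] of arrows, let the Vaught
   transform $A^{\Delta V}$ be the set of the [x] such that [g x] lies in [A]
   for nonmeagrely many [g] in [V] with source [p x].  Close a countable family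
   generating the Borel structure into a countable Boolean algebra [BB] which is
   stable under $A \mapsto A^{\Delta U_n}$ for a base [U] of the groupoid and is
   a base of a zero-dimensional Polish topology on [X].  The sought topology is
   generated by the sets $A^{\Delta U_n}$ with [A] in [BB].  It is a quotient:
   call [y] generic if it lies locally comeagrely, at the identity arrow, in
   each member of [BB] containing it; the generic points of an orbit are
   comeager, and $(g, y) \mapsto g^{-1} y$, restricted to generic [y], is a
   continuous open surjection onto [X], from a space complete in the sense of
   Cech.  Completeness passes to regular open images, and regular second
   countable Cech complete spaces are Polish by Urysohn's metrization.  Lusin's
   separation argument shows that the new topology has the same Borel sets. *)

Require Import Defs.
From HB Require Import structures.
From mathcomp Require Import all_boot all_order all_algebra.
From mathcomp Require Import all_classical all_reals all_analysis.
From mathcomp Require Import lra.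

Set Implicit Arguments.
Unset Strict Implicit.
Unset Printing Implicit Defensive.

Import Order.TTheory GRing.Theory Num.Theory.
Import numFieldNormedType.Exports.
Local Open Scope classical_set_scope.

(** * A metric-free characterization of Polish spaces *)

(** The image of $V \times B$ under $(g, y) \mapsto g^{-1} y$ consists of the $x$ that at least one
    arrow of $V$ sends into $B$; it may exceed $B^{\Delta V}$ and need not be open. Restricted to
    generic $y$ it is exactly $B^{\Delta V}$, since one arrow to a generic point of $B$ already
    yields nonmeagerly many. Continuity is where the stability of the algebra enters: writing $k =
    (k g^{-1}) g$, the condition $x \in A^{\Delta V}$ is guaranteed by $g x \in A^{\Delta U_i}$ for
    a suitable $i$, and this must again be a condition from the algebra. Nonmeagerness is the right
    quantifier because it passes to one term of a countable union, which selects such an $i$.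

    The arrow space is only locally Polish and need not be Hausdorff, and the quotient has no metric
    to start from. Covers and ultrafilters express completeness on both sides, and they can be
    pushed through a map that is merely open. *)

Section ultrafilters.
Context {T : Type} (F : set_system T) {FU : UltraFilter F}.

Lemma ultra_setC (A : set T) : ~ F A -> F (~` A).
Proof. by case: (in_ultra_setVsetC A FU). Qed.

Lemma ultra_not (A B : set T) : F A -> F B -> ~ (A `<=` ~` B).
Proof.
move=> FA FB AB; have FAB : F (A `&` B) by exact: filterI.
by have [x [/AB nBx Bx]] := filter_ex FAB.
Qed.

Lemma ultra_notC (A : set T) : F A -> ~ F (~` A).
Proof. by move=> FA FCA; apply: (ultra_not FA FCA) => x Ax; apply. Qed.

Lemma ultra_bigcup_lt (A : nat -> set T) m :
  F (\bigcup_(i in [set i | (i < m)%N]) A i) -> exists i, F (A i).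
Proof.
move=> FA; apply: contrapT => nA.
have : F (\bigcap_(i in [set i | (i < m)%N]) ~` A i).
  elim: m {FA} => [|m IH].
    by rewrite (_ : \bigcap_(_ in _) _ = setT); [exact: filterT|apply/seteqP].
  have FAm : F (~` A m) by apply: ultra_setC => FAm; apply: nA; exists m.
  apply: filterS (filterI IH FAm) => x [Ax Amx] i; rewrite /= ltnS leq_eqVlt.
  by case/orP => [/eqP ->//|im]; exact: Ax.
by move/(ultra_not FA); apply => x [i im Aix] /(_ i im).
Qed.

Lemma ultra_comap U (f : T -> U) : UltraFilter [set A | F (f @^-1` A)].
Proof.
have pF : ProperFilter [set A | F (f @^-1` A)] by exact: fmap_proper_filter.
split => // G GP FG; apply/seteqP; split => // A GA /=.
apply: contrapT => /ultra_setC nFA; have GCA : G (~` A) := FG (~` A) nFA.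
have GAA : G (A `&` ~` A) by exact: filterI.
by have [x []] := filter_ex GAA.
Qed.

End ultrafilters.

Section polish_opens.
Context {X : Type}.
Implicit Types (op : set (set X)) (r : nat -> nat -> set X) (b : nat -> set X).

Definition converges op (F : set_system X) (x : X) :=
  forall U, op U -> U x -> F U.

Definition separated_opens op := forall x y, x <> y ->
  exists U V, [/\ op U, op V, U x, V y & U `<=` ~` V].

Definition regular_opens op := forall U x, op U -> U x ->
  exists V W, [/\ op V, op W, V x, V `<=` ~` W & ~` W `<=` U].

Definition open_base op b := (forall n, op (b n)) /\
  forall U x, op U -> U x -> exists n, b n x /\ b n `<=` U.

(* Completeness in the sense of Cech and Frolik, expressed without a metric. *)
Definition complete_covers op r := [/\ forall n k, op (r n k),
  forall n x, exists k, r n k x &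
  forall F, UltraFilter F -> (forall n, exists k, F (r n k)) ->
    exists x, converges op F x].

Definition polish_opens op := [/\ separated_opens op, regular_opens op,
  exists b, open_base op b & exists r, complete_covers op r].

End polish_opens.

(** The default [t] fills the indices that code no member of [B], so that finite and empty families
    are enumerated too. *)
Lemma countable_enum {T : Type} (t : T) (B : set T) : countable B ->
  exists b : nat -> T, B `<=` range b /\ range b `<=` B `|` [set t].
Proof.
move=> /countable_injP[f injf].
have /choice[b bP] : forall n, exists y,
    (B y /\ f y = n) \/ (y = t /\ ~ exists z, B z /\ f z = n).
  move=> n; have [[y By]|nB] := pselect (exists y, B y /\ f y = n).
    by exists y; left.
  by exists t; right.
exists b; split=> [y By|_ [n _ <-]]; last by case: (bP n) => -[]; [left|right].
exists (f y) => //; case: (bP (f y)) => [[Bb fb]|[_]]; last by case; exists y.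
by apply: injf => //; exact: mem_set.
Qed.

Local Open Scope ring_scope.

Lemma invS_lt {R : realType} (e : R) : 0 < e -> exists k, k.+1%:R^-1 < e.
Proof. by move=> /ltr_add_invr[k]; rewrite add0r; exists k. Qed.

Section metric_is_polish_opens.
Context {R : realType} {M : metricType R}.

Lemma openP_mdist (U : set M) :
  open U <-> forall x, U x -> exists2 e, 0 < e & forall y, mdist x y < e -> U y.
Proof.
rewrite openE; split => [oU x Ux|oU x Ux].
  by have := oU x Ux; rewrite /interior -metricType_numDomainType.filter_from_mdist_nbhs => -[e]; exists e.
have [e e0 xU] := oU x Ux.
by rewrite /interior -metricType_numDomainType.filter_from_mdist_nbhs; exists e.
Qed.

Lemma open_mdist_lt (x : M) (e : R) : open [set y | mdist x y < e].
Proof.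
apply/openP_mdist => y /= xy; exists (e - mdist x y); first by rewrite subr_gt0.
by move=> z yz; rewrite (le_lt_trans (metric_triangle x y z))// addrC -ltrBrDr.
Qed.

Lemma open_mdist_gt (x : M) (e : R) : open [set y | e < mdist x y].
Proof.
apply/openP_mdist => y /= xy; exists (mdist x y - e); first by rewrite subr_gt0.
move=> z yz; have := metric_triangle x z y; rewrite (metric_sym z y) -lerBlDr.
by apply: lt_le_trans; rewrite ltrBrDl -ltrBrDr.
Qed.


Lemma complete_polish_opens : separable M ->
  (forall F : set_system M, ProperFilter F -> cauchy F ->
     exists l : M, F --> l) ->
  polish_opens (@open M).
Proof.
move=> [D cD denseD] complM.
(* Points are enumerated as singletons with default [set0], because an empty [M] has no default
   point. *)
have [|d [Dd dD]] := countable_enum set0 (B := set1 @` D).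
  exact: sub_countable (card_image_le _ _) cD.
have d1 n x y : d n x -> d n y -> x = y.
  by have [[z _ <-]|->//] := dD _ (imageT d n) => -> ->.
have dnear (e : R) x : 0 < e -> exists n y, d n y /\ mdist y x < e.
  move=> e0; have [] := denseD _ _ (open_mdist_lt x e).
    by exists x; rewrite /= mdistxx.
  move=> y [/= xy Dy]; have [n _ dny] := Dd _ (imageP set1 Dy).
  by exists n, y; rewrite dny metric_sym.
pose b (n : nat) : set M := if unpickle n is Some (i, k) then
  [set y | exists x, d i x /\ mdist x y < k.+1%:R^-1] else set0.
(* An ultrafilter with a member in every row contains balls of every radius, hence is Cauchy. *)
pose r (n k : nat) : set M := [set y | exists x, d k x /\ mdist x y < n.+1%:R^-1].
have open_near k (e : R) : open [set y | exists x, d k x /\ mdist x y < e].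
  rewrite (_ : [set _ | _] = \bigcup_(x in d k) [set y | mdist x y < e]).
    by apply: bigcup_open => x _; exact: open_mdist_lt.
  by apply/seteqP; split => [y [x []]|y [x dx xy]]; exists x.
have regM : regular_opens (@open M).
  move=> U x /openP_mdist oU /oU[e e0 xU].
  exists [set y | mdist x y < e / 2], [set y | e / 2 < mdist x y]; split.
  - exact: open_mdist_lt.
  - exact: open_mdist_gt.
  - by rewrite /= mdistxx divr_gt0.
  - by move=> y /= xy; rewrite ltNge (ltW xy).
  - move=> y /= /negP; rewrite -leNgt => xy; apply: xU.
    by rewrite (le_lt_trans xy)// gtr_pMr// invf_lt1// ltr1n.
split=> //.
- move=> x y /eqP; rewrite -mdist_gt0 => xy.
  exists [set z | mdist x z < mdist x y / 2], [set z | mdist x y / 2 < mdist x z].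
  split; [exact: open_mdist_lt|exact: open_mdist_gt| | |].
  + by rewrite /= mdistxx divr_gt0.
  + by rewrite /= gtr_pMr// invf_lt1// ltr1n.
  + by move=> z /= xz; rewrite ltNge (ltW xz).
- exists b; split=> [n|U x /openP_mdist oU /oU[e e0 xU]].
    by rewrite /b; case: unpickle => [[i k]|]; [exact: open_near|exact: open0].
  have [k ke] : exists k, k.+1%:R^-1 < e / 2 by apply: invS_lt; rewrite divr_gt0.
  have [|n [y [dny yx]]] := dnear k.+1%:R^-1 x; first by rewrite invr_gt0.
  exists (pickle (n, k)); rewrite /b pickleK; split; first by exists y.
  move=> z [y' [/(d1 _ _ _ dny) <- yz]]; apply: xU.
  rewrite (le_lt_trans (metric_triangle x y z))// (splitr e) metric_sym.
  by rewrite ltrD// (lt_trans _ ke).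
- exists r; split => [n k|n x|F FU Fr]; first exact: open_near.
    by have [|k [y dky]] := dnear n.+1%:R^-1 x; [rewrite invr_gt0|exists k, y].
  have [|x Fx] := complM F _.
  + apply/cauchy_exP => e e0; have [n ne] := invS_lt e0.
    have [k Frnk] := Fr n; have [_ [x [dkx _]]] := filter_ex Frnk.
    exists x; apply: filterS Frnk => z [y [/(d1 _ _ _ dkx) <- yz]].
    by rewrite ballEmdist /= (lt_trans yz).
  + by exists x => U oU Ux; apply: Fx; exact: open_nbhs_nbhs.
Qed.

End metric_is_polish_opens.

Lemma polish_polish_opens (R : realType) (T : topologicalType) :
  polish R T -> polish_opens (@open T).
Proof.
move=> [[m [Mo complM]] [D cD denseD]].
rewrite -Mo; apply: (@complete_polish_opens R (Metric.Pack m)) => //.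
by exists D => // U U0; rewrite Mo; exact: denseD.
Qed.

(** Tychonoff's lemma: each closed set is covered by basic sets whose closures miss the other one,
    and from each basic set the closures of the opposing ones of no larger index are removed.
    Comparing indices gives disjointness. *)
Lemma regular_normal (R : realType) (T : topologicalType) (b : nat -> set T) :
  regular_opens (@open T) -> open_base (@open T) b -> normal_space T.
Proof.
move=> regT [ob baseb]; apply/(@normal_openP R) => A B cA cB AB.
pose small C n := closure (b n) `<=` ~` C.
pose shrink (C D : set T) := \bigcup_(n in small D)
  (b n `\` \bigcup_(m in [set m | small C m /\ (m <= n)%N]) closure (b m)).
have open_shrink C D : open (shrink C D).
  apply: bigcup_open => n _; apply: openI => //; apply: closed_openC.
  apply: closed_bigcup => [|m _]; last exact: closed_closure.
  by apply: sub_finite_set (finite_II n.+1) => m [_].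
have sub_shrink C D : closed D -> C `&` D = set0 -> C `<=` shrink C D.
  move=> cD CD x Cx; have nDx : (~` D) x by move=> Dx; rewrite -[False]/(set0 x) -CD.
  have [V [W [oV oW Vx VW WD]]] := regT _ _ (closed_openC cD) nDx.
  have [n [bnx bnV]] := baseb _ _ oV Vx.
  exists n.
    apply: subset_trans WD; apply: subset_trans (open_closedC oW).
    by apply: closureS; exact: subset_trans VW.
  by split => // -[m [smallm _]] /smallm.
exists (shrink A B), (shrink B A); split => //.
- exact: sub_shrink.
- by apply: sub_shrink => //; rewrite setIC.
apply/seteqP; split => // x [[n Bn [bnx nn]] [m Am [bmx mm]]].
have [mn|nm] := leqP m n.
- by apply: nn; exists m => //; exact: subset_closure.
- by apply: mm; exists n => //; [split => //; exact: ltnW|exact: subset_closure].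
Qed.

(** * Metrization by countably many real functions, and complete metrization *)

Section distance_of_functions.
Context {R : realType} {T : choiceType} (h : nat -> T -> R).
Hypothesis separating : forall x y, (forall n, h n x = h n y) -> x = y.

(** The cap $1/(n+1)$ leaves only finitely many [n] that can exceed a given size, so a supremum does
    the work of a weighted series. *)
Let term x y n : R := Num.min n.+1%:R^-1 `|h n x - h n y|.

Definition fdist x y : R := sup (range (term x y)).

Let has_sup_term x y : has_sup (range (term x y)).
Proof.
split; first by exists (term x y 0%N); exists 0%N.
exists 1 => _ [n _ <-]; rewrite /term ge_min invf_le1 ?ltr0n// ler1n.
by rewrite ltnS leq0n.
Qed.

Lemma fdist_ge x y n : term x y n <= fdist x y.
Proof. by apply: sup_upper_bound => //; exists n. Qed.

Lemma fdist_le x y e : (forall n, term x y n <= e) -> fdist x y <= e.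
Proof.
move=> le_e; apply: ge_sup; first by exists (term x y 0%N); exists 0%N.
by move=> _ [n _ <-].
Qed.

Let term_ge0 x y n : 0 <= term x y n.
Proof. by rewrite le_min normr_ge0 invr_ge0 ler0n. Qed.

Lemma fdistxx x : fdist x x = 0.
Proof.
apply/eqP; rewrite eq_le (le_trans (term_ge0 x x 0%N) (fdist_ge x x 0%N)) andbT.
by apply: fdist_le => n; rewrite /term subrr normr0 ge_min lexx orbT.
Qed.

Lemma fdist_eq0 x y : fdist x y = 0 -> x = y.
Proof.
move=> xy0; apply: separating => n; have := fdist_ge x y n; rewrite xy0.
rewrite ge_min invr_le0 lern0 /= normr_le0 subr_eq0 => /eqP.
by [].
Qed.

Lemma fdist_sym x y : fdist x y = fdist y x.
Proof. by congr sup; apply: eq_imagel => n _; rewrite /term distrC. Qed.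

Lemma fdist_triangle y x z : fdist x z <= fdist x y + fdist y z.
Proof.
apply: fdist_le => n; rewrite (le_trans _ (lerD (fdist_ge x y n) (fdist_ge y z n)))//.
rewrite /term; have := ler_distD (h n y) (h n x) (h n z).
have : 0 <= n.+1%:R^-1 :> R by rewrite invr_ge0.
move: (normr_ge0 (h n x - h n y)) (normr_ge0 (h n y - h n z)).
move: `|h n x - h n y| `|h n y - h n z| `|h n x - h n z| (n.+1%:R^-1).
move=> a b c i; rewrite /Num.min.
by do 3!case: ltP => ?; move=> *; lra.
Qed.

(** An alias of [T] indexed by the separation proof, so that a metric instance can be declared
    beside the structures of [T]. *)
Definition fdist_type of (forall x y, (forall n, h n x = h n y) -> x = y) : Type :=
  T.
HB.instance Definition _ := Choice.on (fdist_type separating).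
HB.instance Definition _ :=
  @isMetric.Build R (fdist_type separating) fdist fdistxx fdist_eq0 fdist_sym fdist_triangle.

Lemma fdist_small e : 0 < e ->
  exists N, forall x y, (forall n, (n < N)%N -> `|h n x - h n y| < e) -> fdist x y <= e.
Proof.
move=> /invS_lt[N Ne]; exists N => x y xy; apply: fdist_le => n; rewrite /term ge_min.
have [/xy/ltW ->|Nn] := ltnP n N; first by rewrite orbT.
by rewrite (le_trans _ (ltW Ne))// lef_pV2 ?posrE// ler_nat ltnS.
Qed.

Lemma dist_fun_small n e : 0 < e ->
  exists2 d, 0 < d & forall x y, fdist x y < d -> `|h n x - h n y| < e.
Proof.
move=> e0; exists (Num.min e n.+1%:R^-1); first by rewrite lt_min e0 invr_gt0/=.
move=> x y; rewrite lt_min => /andP[xye xyn].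
have := fdist_ge x y n; rewrite ge_min => /orP[|/le_lt_trans]; last exact.
by rewrite leNgt xyn.
Qed.

End distance_of_functions.

Lemma near_lt (T : topologicalType) (P : nat -> set T) (x : T) N :
  (forall n, \forall y \near x, P n y) ->
  \forall y \near x, forall n, (n < N)%N -> P n y.
Proof.
move=> nP; elim: N => [|N IH]; first exact: nearW.
apply: filterS (filterI IH (nP N)) => y [Py PNy] n.
by rewrite ltnS leq_eqVlt => /orP[/eqP ->|/Py].
Qed.

Section metrization.
Context {R : realType} {T : topologicalType}.

Definition initial_functions (h : nat -> T -> R) :=
  (forall n, continuous (h n)) /\ forall (U : set T) x, open U -> U x ->
    exists n, exists2 e, 0 < e & forall y, `|h n x - h n y| < e -> U y.

Lemma initial_functions_separating h : initial_functions h ->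
  separated_opens (@open T) -> forall x y, (forall n, h n x = h n y) -> x = y.
Proof.
move=> [_ ih] sepT x y hxy; apply: contrapT => /sepT[U [V [oU _ Ux Vy UV]]].
have [n [e e0]] := ih _ _ oU Ux.
by move/(_ y); rewrite hxy subrr normr0 => /(_ e0)/UV.
Qed.

Lemma fdist_open h (sep : forall x y, (forall n, h n x = h n y) -> x = y) :
  initial_functions h -> @open (fdist_type sep) = @open T.
Proof.
move=> [ch ih]; apply/seteqP; split => U.
  move=> /openP_mdist oU; rewrite openE => x /oU[e e0 xU].
  have e20 : 0 < e / 2 by rewrite divr_gt0.
  have [N hN] := fdist_small h e20.
  have : \forall y \near x, forall n, (n < N)%N -> `|h n x - h n y| < e / 2.
    by apply: near_lt => n; have /cvgrPdist_lt := ch n x; apply.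
  apply: filterS => y xy; apply: xU; apply: le_lt_trans (hN _ _ xy) _.
  by rewrite gtr_pMr// invf_lt1// ltr1n.
move=> oU; apply/openP_mdist => x /(ih _ _ oU)[n [e e0 xU]].
by have [d d0 hd] := dist_fun_small h n e0; exists d => // y /hd/xU.
Qed.

Lemma urysohn_functions b : normal_space T -> regular_opens (@open T) ->
  open_base (@open T) b -> exists h, initial_functions h.
Proof.
move=> normalT regT [ob baseb].
exists (fun n => if unpickle n is Some (i, j)
  then Urysohn (closure (b i)) (~` b j) else cst 0); split.
  by move=> n; case: unpickle => [[i j]|]; [exact: Urysohn_continuous|exact: cst_continuous].
move=> U x oU Ux; have [j [bjx bjU]] := baseb _ _ oU Ux.
have [V [W [oV oW Vx VW WU]]] := regT _ _ (ob j) bjx.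
have [i [bix biV]] := baseb _ _ oV Vx.
have cbi : closure (b i) `<=` b j.
  apply: subset_trans WU; apply: subset_trans (open_closedC oW).
  by apply: closureS; exact: subset_trans VW.
have sep : uniform_separator (closure (b i)) (~` b j).
  move/(@normal_separatorP R) : normalT; apply; first exact: closed_closure.
    exact: open_closedC.
  by apply/disjoints_subset; rewrite setCK.
exists (pickle (i, j)); rewrite pickleK; exists 1 => // y.
rewrite (_ : Urysohn _ _ x = 0); last first.
  by apply: (Urysohn_sub0 sep); exists x => //; exact: subset_closure.
apply: contraPP => /= nUy; rewrite (_ : Urysohn _ _ y = 1).
  by rewrite sub0r normrN normr1 ltxx.
by apply: (Urysohn_sub1 sep); exists y => // /bjU.
Qed.

End metrization.

Section completion.
Context {R : realType} {M : metricType R} (r : nat -> nat -> set M).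
Hypothesis rO : forall n k, open (r n k).
Hypothesis rcover : forall n x, exists k, r n k x.

Let radii n x : set R :=
  [set s | [/\ 0 <= s, s <= 1 & exists k, forall y, mdist x y < s -> r n k y]].

(** A pointwise Lebesgue number of the [n]-th cover; the bound by 1 keeps it finite when a member of
    the cover is the whole space. *)
Definition cover_radius n x : R := sup (radii n x).

Let radii0 n x : radii n x 0.
Proof.
split=> //; have [k _] := rcover n x; exists k => y.
by rewrite ltNge mdist_ge0.
Qed.

Let has_sup_radii n x : has_sup (radii n x).
Proof. by split; [exists 0|exists 1 => s []]. Qed.

Lemma cover_radius_gt0 n x : 0 < cover_radius n x.
Proof.
have [k rx] := rcover n x; have [e e0 xe] := (openP_mdist _).1 (rO n k) x rx.
apply: (@lt_le_trans _ _ (Num.min e 1)); first by rewrite lt_min e0 ltr01.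
apply: sup_upper_bound => //; split; first by rewrite le_min (ltW e0) ler01.
  by rewrite ge_min lexx orbT.
by exists k => y; rewrite lt_min => /andP[/xe].
Qed.

Lemma cover_radius_le n x y : cover_radius n x <= cover_radius n y + mdist x y.
Proof.
apply: ge_sup; first by exists 0.
move=> s [s0 s1 [k xk]]; rewrite -lerBlDr.
have [sxy|/ltW sxy] := leP 0 (s - mdist x y); last first.
  by rewrite (le_trans sxy)// ltW// cover_radius_gt0.
apply: sup_upper_bound => //; split => //.
  by rewrite (le_trans _ s1)// gerBl mdist_ge0.
exists k => z yz; apply: xk.
by rewrite (le_lt_trans (metric_triangle x y z))// addrC -ltrBrDr.
Qed.

Lemma cover_radius_ball n x s : s < cover_radius n x ->
  exists k, forall y, mdist x y < s -> r n k y.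
Proof.
move=> /(sup_gt (has_sup_radii n x).1)[t [t0 t1 [k xk]] st].
by exists k => y xy; apply: xk; exact: lt_trans st.
Qed.

Lemma cover_radius_continuous n : continuous (cover_radius n).
Proof.
move=> x; apply/cvgrPdist_lt => e e0.
apply: filterS (_ : nbhs x [set y | mdist x y < e]); last first.
  by apply: open_nbhs_nbhs; split; [exact: open_mdist_lt|rewrite /= mdistxx].
move=> y /= xy; rewrite ltr_norml; apply/andP; split.
  rewrite ltrBrDr addrC ltrBlDr (le_lt_trans (cover_radius_le n y x))//.
  by rewrite ltrD2l metric_sym.
by rewrite ltrBlDr addrC (le_lt_trans (cover_radius_le n x y))// ltrD2l.
Qed.

End completion.

Lemma open_base_separable (T : topologicalType) (b : nat -> set T) :
  open_base (@open T) b -> separable T.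
Proof.
move=> [ob baseb].
pose D n := [set x : T | exists H : b n !=set0, x = projT1 (cid H)].
exists (\bigcup_n D n).
  apply: bigcup_countable => // n _.
  have [bn|bn] := pselect (b n !=set0).
    apply: sub_countable (countable1 (projT1 (cid bn))).
    by apply: subset_card_le => x [H ->]; rewrite (Prop_irrelevance H bn).
  by rewrite (_ : D n = set0)//; apply/seteqP; split => // x [].
move=> U [x Ux] oU; have [n [bnx bnU]] := baseb _ _ oU Ux.
have bn : b n !=set0 by exists x.
exists (projT1 (cid bn)); split; last by exists n => //; exists bn.
by apply: bnU; exact: (projT2 (cid bn)).
Qed.

(** The reciprocals of the cover radii join the Urysohn functions as coordinates of a second
    compatible metric. A filter that is Cauchy for it contains a set on which the [n]-th reciprocal
    is bounded, hence a small set inside one member of the [n]-th cover. *)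
Lemma polish_opens_polish (R : realType) (T : topologicalType) :
  polish_opens (@open T) -> polish R T.
Proof.
move=> [sepT regT [b bT] [r [rO rcover cr]]].
have [f initf] := @urysohn_functions R T b (regular_normal R regT bT) regT bT.
pose M := fdist_type (initial_functions_separating initf sepT).
have MT : @open M = @open T by exact: fdist_open.
have MO n k : @open M (r n k) by rewrite MT.
pose h n : T -> R := if odd n
  then fun x => (@cover_radius R M r n./2 x)^-1 else f n./2.
have inith : initial_functions h.
  split=> [n|U x oU Ux].
    rewrite /h; case: ifP => _; last exact: initf.1.
    move=> x; apply: cvgV; first by rewrite gt_eqF// cover_radius_gt0.
    move: x; apply/continuousP => A oA; rewrite -MT.
    by move: A oA; apply/continuousP; exact: cover_radius_continuous.
  have [n [e e0 xU]] := initf.2 _ _ oU Ux; exists n.*2; exists e => // y.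
  by rewrite /h odd_double doubleK; exact: xU.
pose D := fdist_type (initial_functions_separating inith sepT).
have DT : @open D = @open T by exact: fdist_open.
split; last exact: open_base_separable bT.
exists (Metric.class D); split=> // F FF /cauchy_ballP Fcauchy.
(* The covers control ultrafilters only; a limit of [G] is one of [F] because [F] is Cauchy. *)
have [G [GU FG]] := ultraFilterLemma FF.
have Gsmall n (e : R) : 0 < e -> exists2 E, F E & forall x y, E x -> E y -> `|h n x - h n y| < e.
  move=> /(dist_fun_small h n)[d d0 hd]; have [[E1 E2] /= [FE1 FE2] E12] := Fcauchy _ d0.
  exists (E1 `&` E2); first exact: filterI.
  move=> x y [E1x _] [_ E2y]; apply: hd.
  by have := E12 (x, y) (conj E1x E2y); rewrite /= ballEmdist.
have Msmall (e : R) : 0 < e -> exists2 E, F E & forall x y, E x -> E y -> fdist f x y < e.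
  move=> e0; have e20 : 0 < e / 2 by rewrite divr_gt0.
  have [N fN] := fdist_small f e20.
  have [E FE EN] : exists2 E, F E & forall n, (n < N)%N ->
      forall x y, E x -> E y -> `|f n x - f n y| < e / 2.
    elim: N {fN} => [|N [E FE EN]]; first by exists setT => //; exact: filterT.
    have [E' FE'] := Gsmall N.*2 _ e20; rewrite /h odd_double doubleK => EN'.
    exists (E `&` E'); first exact: filterI.
    move=> n; rewrite ltnS leq_eqVlt => /orP[/eqP ->|nN] x y [Ex E'x] [Ey E'y].
      exact: EN'.
    exact: EN.
  exists E => // x y Ex Ey; apply: le_lt_trans (fN _ _ _) _.
    by move=> n nN; exact: EN.
  by rewrite gtr_pMr// invf_lt1// ltr1n.
have [|x Gx] := cr G GU.
  move=> n; have [E FE En] := Gsmall n.*2.+1 _ ltr01.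
  have [x0 Ex0] := filter_ex FE.
  (* On [E] the reciprocal radius varies by less than 1, so the radius exceeds [c] there; a set of
     diameter below [c] that meets [E] fits into one member of the cover. *)
  pose c := (h n.*2.+1 x0 + 1)^-1.
  have rE (x : T) : @cover_radius R M r n x = (h n.*2.+1 x)^-1.
    by rewrite /h /= odd_double /= invrK uphalf_double.
  have h0 (x : T) : 0 < h n.*2.+1 x.
    by rewrite -invr_gt0 -rE; exact: (@cover_radius_gt0 R M).
  have c0 : 0 < c by rewrite invr_gt0 addr_gt0.
  have [E' FE' cE'] := Msmall _ c0.
  have FEE' : F (E `&` E') by exact: filterI.
  have [x [Ex E'x]] := filter_ex FEE'.
  have [|k xk] := @cover_radius_ball R M r rcover n x c.
    rewrite rE ltf_pV2 ?posrE ?addr_gt0//.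
    by have := En _ _ Ex Ex0; rewrite ltr_norml ltrBlDl => /andP[].
  by exists k; apply: FG; apply: filterS FE' => y E'y; apply: xk; exact: cE'.
exists x => U; rewrite -metricType_numDomainType.filter_from_mdist_nbhs => -[e /= e0 xU].
have e20 : 0 < e / 2 by rewrite divr_gt0.
have [[E1 E2] /= [FE1 FE2] E12] := Fcauchy _ e20.
have GB : G [set y | fdist h x y < e / 2].
  apply: Gx; last by rewrite /= fdistxx.
  by rewrite -DT; exact: (@open_mdist_lt R D).
have GE1 : G E1 by exact: FG.
have GBE : G ([set y | fdist h x y < e / 2] `&` E1) by exact: filterI.
have [y [xy E1y]] := filter_ex GBE.
apply: filterS FE2 => z E2z; apply: xU; rewrite (splitr e).
have /= := E12 (y, z) (conj E1y E2z); rewrite ballEmdist => yz.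
by rewrite (le_lt_trans (@metric_triangle _ D x y z))// ltrD.
Qed.

Theorem polishP (R : realType) (T : topologicalType) :
  polish R T <-> polish_opens (@open T).
Proof. by split; [exact: polish_polish_opens|exact: polish_opens_polish]. Qed.

Local Close Scope ring_scope.

(** * Refining a Polish topology by countably many Borel sets *)

Lemma countable_range_nat {T : Type} (f : nat -> T) : countable (range f).
Proof. exact: sub_countable (card_image_le _ _) (countableP _). Qed.

Lemma countableU {T : Type} (A B : set T) :
  countable A -> countable B -> countable (A `|` B).
Proof. by move=> cA cB; rewrite -bigcup2E; apply: bigcup_countable => // -[|[|n]]. Qed.

Section good_families.
Context {X : Type}.
Implicit Types (A : set X) (B : set (set X)) (C : set (nat -> set X)).

(* The sets in [B] and their complements form a subbase of a Polish topology:
   the indicator functions of the members of [B] identify [X] with a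
   $G_\delta$ subset of a Cantor space, cut out by the covers in [C]. *)
Definition good B C := [/\ countable B, countable C,
  forall c k, C c -> B (c k),
  forall c x, C c -> exists k, c k x &
  forall F, UltraFilter F -> (forall c, C c -> exists k, F (c k)) ->
    exists x, forall A, B A -> (F A <-> A x)].

Definition separates_points B :=
  forall x y, (forall A, B A -> (A x <-> A y)) -> x = y.

Lemma good_limit B C F : good B C -> UltraFilter F ->
  (forall c, C c -> exists k, F (c k)) ->
  exists x, forall A, B A -> (F A <-> A x).
Proof. by case=> _ _ _ _; apply. Qed.

(** Basic sets are not closed in [op]: a limit [x] only gives that [b i x] implies [F (b i)]. The
    cover [q i] supplies the converse, since an ultrafilter containing [b i] must then contain some
    [b j] with closure inside [b i]. *)
Lemma good_polish_opens (op : set (set X)) : polish_opens op ->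
  exists B C, [/\ good B C, separates_points B & <<s B >> = <<s op >>].
Proof.
move=> [sepX regX [b [ob baseb]] [r [ro rcover cr]]].
(* The side condition does not depend on the point, so each such set is [b j] or empty and lies in
   [B]. *)
pose p (n j : nat) : set X := [set x | b j x /\ exists k, b j `<=` r n k].
pose q (i j : nat) : set X := if j is j.+1
  then [set x | b j x /\ exists W, [/\ op W, b j `<=` ~` W & ~` W `<=` b i]]
  else ~` b i.
have trim j (P : Prop) : [set x | b j x /\ P] = b j \/ [set x | b j x /\ P] = set0.
  have [h|h] := pselect P; [left|right]; apply/seteqP; split => x //=.
    by case.
  by case.
pose B := [set set0] `|` range b `|` range (fun j => ~` b j).
exists B, (range p `|` range q); split.
- split.
  + do !apply: countableU; [exact: countable1|exact: countable_range_nat..].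
  + by apply: countableU; exact: countable_range_nat.
  + move=> c k [[n _ <-]|[i _ <-]]; last case: k => [|k] /=.
    * rewrite /p; have [->|->] := trim k (exists m, b k `<=` r n m);
        left; [right; by exists k|by left].
    * by right; exists i.
    * have [->|->] := trim k (exists W, [/\ op W, b k `<=` ~` W & ~` W `<=` b i]);
        left; [right; by exists k|by left].
  + move=> c x [[n _ <-]|[i _ <-]].
      have [k rx] := rcover n x; have [j [bx bjr]] := baseb _ _ (ro n k) rx.
      by exists j; split => //; exists k.
    have [bix|nbix] := pselect (b i x); last by exists 0%N.
    have [V [W [oV oW Vx VW WU]]] := regX _ _ (ob i) bix.
    have [j [bjx bjV]] := baseb _ _ oV Vx.
    by exists j.+1; split => //; exists W; split => //; exact: subset_trans VW.
  + move=> F FU FC.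
    have [|x Fx] := cr F FU.
      move=> n; have [j Fj] := FC (p n) (or_introl (imageT _ _)).
      have [x [_ [k bjr]]] := filter_ex Fj.
      by exists k; apply: filterS Fj => y [/bjr].
    have Fb i : F (b i) <-> b i x.
      split=> [Fbi|]; last exact: Fx.
      have [[/(ultra_notC Fbi)//|j Fj]] := FC (q i) (or_intror (imageT _ _)).
      have [_ [_ [W [oW bjW WU]]]] := filter_ex Fj.
      apply: WU => Wx; apply: (ultra_not Fj (Fx W oW Wx)) => y [].
      by move=> /bjW.
    exists x => A [[->|[i _ <-//]]|[i _ <-]].
      by split => // /filter_ex[].
    split=> [FnA bix|nbix]; last by apply: ultra_setC => /Fb.
    by apply: (ultra_notC _ FnA); exact/Fb.
- move=> x y xy; apply: contrapT => /sepX[U [V [oU _ Ux Vy UV]]].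
  have [n [bnx bnU]] := baseb _ _ oU Ux.
  have Bb : B (b n) by left; right; exists n.
  by have /bnU/UV := (xy _ Bb).1 bnx.
apply/seteqP; split; apply: smallest_sub; try exact: smallest_sigma_algebra.
  move=> A [[->|[i _ <-]]|[i _ <-]]; first exact: sigma_algebra0.
    exact: sub_sigma_algebra.
  by rewrite -setTD; apply: sigma_algebraCD; exact: sub_sigma_algebra.
move=> U oU; rewrite (_ : U = \bigcup_n [set x | b n x /\ b n `<=` U]).
  apply: sigma_algebra_bigcup => n; apply: sub_sigma_algebra; left.
  by have [->|->] := trim n (b n `<=` U); [right; exists n|left].
apply/seteqP; split => [x /(baseb _ _ oU)[n []]|x [n _ [bnx]]]; last exact.
by exists n.
Qed.

(** The join of Polish topologies above a common Hausdorff one: the limits found in the various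
    [B i] agree on [B0], hence coincide. This is the closed diagonal in the product of the
    spaces. *)
Lemma good_bigcup I (D : set I) (B0 : set (set X)) (B : I -> set (set X))
    (C : I -> set (nat -> set X)) : countable D -> D !=set0 ->
  separates_points B0 -> (forall i, D i -> B0 `<=` B i) ->
  (forall i, D i -> good (B i) (C i)) ->
  good (\bigcup_(i in D) B i) (\bigcup_(i in D) C i).
Proof.
move=> cD [i0 Di0] sepB0 B0B gBC; split.
- by apply: bigcup_countable => // i /gBC[].
- by apply: bigcup_countable => // i /gBC[].
- by move=> c k [i Di Cic]; exists i => //; have [_ _ + _ _] := gBC _ Di; apply.
- by move=> c x [i Di Cic]; have [_ _ _ + _] := gBC _ Di; apply.
move=> F FU FC.
have Fi i : D i -> exists x, forall A, B i A -> (F A <-> A x).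
  move=> Di; apply: (good_limit (gBC _ Di)) => c Cic.
  by apply: FC; exists i.
have [x0 Fx0] := Fi _ Di0; exists x0 => A [i Di BA].
have [x Fx] := Fi _ Di; suff -> : x0 = x by exact: Fx.
apply: sepB0 => A' B0A'; rewrite -(Fx0 A'); last exact: (B0B _ Di0).
by rewrite -(Fx A')//; exact: (B0B _ Di).
Qed.

Lemma good_setC B C : good B C -> good (B `|` [set ~` A | A in B]) C.
Proof.
move=> [cB cC CB Ccov Clim]; split => //.
- apply: countableU => //; exact: sub_countable (card_image_le _ _) cB.
- by move=> c k /CB Bck; left.
move=> F FU /(Clim F FU)[x Fx]; exists x => A [BA|[A' BA' <-]]; first exact: Fx.
have FA' := Fx _ BA'.
split=> [FnA A'x|nA'x]; last by apply: ultra_setC => /FA'.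
by apply: (ultra_notC _ FnA); exact/FA'.
Qed.

(** The one new cover, made of the complement of the union and the [A n], excludes the ultrafilters
    that contain the union but none of its terms. *)
Lemma good_add_bigcup B C (A : nat -> set X) :
  good B C -> (forall n, B (A n)) -> (forall n, B (~` A n)) ->
  good (B `|` [set \bigcup_n A n] `|` [set ~` \bigcup_n A n])
    (C `|` [set (fun n => if n is n.+1 then A n else ~` \bigcup_n A n)]).
Proof.
move=> [cB cC CB Ccov Clim] BA BnA; split.
- by do !apply: countableU => //; exact: countable1.
- by do !apply: countableU => //; exact: countable1.
- by move=> c [|k] [/CB Bck|->]; [left; left|right|left; left|left; left].
- move=> c x [/Ccov//|->].
  have [[n _ Anx]|nx] := pselect ((\bigcup_n A n) x); first by exists n.+1.
  by exists 0%N.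
move=> F FU FC; have [c Cc|x Fx] := Clim F FU; first by apply: FC; left.
have FA : F (\bigcup_n A n) <-> (\bigcup_n A n) x.
  split => [FA|[n _ /(Fx _ (BA n)).2]]; last by apply: filterS => y; exists n.
  have [[|n] Fn] := FC _ (or_intror erefl); first by have := ultra_notC FA Fn.
  by exists n => //; apply/(Fx _ (BA n)).1.
exists x => D [[BD|->//]|->]; first exact: Fx.
split=> [FnA Ax|nAx]; last by apply: ultra_setC => /FA.
by apply: (ultra_notC _ FnA); exact/FA.
Qed.

(** The sets that some refinement makes clopen form a sigma-algebra; for a countable union, the
    refinements of the terms are joined before the union is adjoined. *)
Lemma good_refine B0 C0 A : good B0 C0 -> separates_points B0 -> <<s B0 >> A ->
  exists B C, [/\ good B C, B0 `<=` B, B `<=` <<s B0 >> & B A].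
Proof.
move=> g0 sep0; pose P A := exists B C,
  [/\ good B C, B0 `<=` B, B `<=` <<s B0 >> & B A].
suff PsA : sigma_algebra setT P.
  apply: (smallest_sub PsA) => A' B0A'; exists B0, C0.
  by split => //; exact: sub_sigma_algebra.
have P0 : P set0.
  exists (B0 `|` [set set0]), C0; split => //; [| |by right].
    have [cB cC CB Ccov Clim] := g0; split => //.
    + by apply: countableU => //; exact: countable1.
    + by move=> c k /CB Bck; left.
    + move=> F FU /(Clim F FU)[x Fx]; exists x => A' [BA'|->]; first exact: Fx.
      by split=> // /filter_ex[].
  by move=> A' [|->]; [exact: sub_sigma_algebra|exact: sigma_algebra0].
split=> // [A' [B [C [gB BB Bs BA']]]|A' PA'].
- exists (B `|` [set ~` D | D in B]), C; split.
  + exact: good_setC.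
  + by move=> D /BB; left.
  + move=> D [/Bs//|[E /Bs sE <-]].
    by rewrite -setTD; exact: sigma_algebraCD.
  + by right; exists A' => //; rewrite setTD.
have /choice[B /choice[C gA']] : forall n, exists B C,
  [/\ good B C, B0 `<=` B, B `<=` <<s B0 >> & B (A' n)] by exact: PA'.
pose B' := (\bigcup_n B n) `|` [set ~` D | D in \bigcup_n B n].
have gB' : good B' (\bigcup_n C n).
  apply: good_setC; apply: (@good_bigcup _ _ B0) => //.
    by move=> n _; have [] := gA' n.
  by move=> n _; have [] := gA' n.
have B's : B' `<=` <<s B0 >>.
  have Bs n : B n `<=` <<s B0 >> by have [] := gA' n.
  move=> D [[n _ /Bs//]|[E [n _ /Bs sE] <-]].
  by rewrite -setTD; exact: sigma_algebraCD.
have BA' n : (\bigcup_n B n) (A' n) by exists n => //; have [] := gA' n.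
have sA' : <<s B0 >> (\bigcup_n A' n).
  by apply: sigma_algebra_bigcup => n; apply: B's; left.
eexists; eexists; split.
- apply: (@good_add_bigcup _ _ A' gB') => n; first by left.
  by right; exists (A' n).
- by move=> D B0D; left; left; left; exists 0%N => //; have [_ + _ _] := gA' 0%N; apply.
- by move=> D [[/B's//|->//]|->]; rewrite -setTD; exact: sigma_algebraCD.
- by left; right.
Qed.

(** The levels of the closure need not be good. Each set [A] brings a good family [BB A] containing
    it, which the next level absorbs; so the union of all levels is a union of good families, and
    [good_bigcup] applies. *)
Lemma good_closure (op : nat -> set X -> set X -> set X) (init : nat -> set X) B0 C0 :
  good B0 C0 -> separates_points B0 -> (forall n, <<s B0 >> (init n)) ->
  (forall n A A', <<s B0 >> A -> <<s B0 >> A' -> <<s B0 >> (op n A A')) ->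
  exists B C, [/\ good B C, B0 `<=` B, B `<=` <<s B0 >>, forall n, B (init n) &
    forall n A A', B A -> B A' -> B (op n A A')].
Proof.
move=> g0 sep0 initS opS.
have /choice[BB /choice[CC gBC]] : forall A, exists B C, <<s B0 >> A ->
    [/\ good B C, B0 `<=` B, B `<=` <<s B0 >> & B A].
  move=> A; have [/(good_refine g0 sep0)[B [C gBC]]|nA] := pselect (<<s B0 >> A).
    by exists B, C.
  by exists set0, set0.
pose step (D : set (set X)) := (\bigcup_(A in D) BB A) `|`
  \bigcup_n \bigcup_(A in D) [set op n A A' | A' in D].
pose lvl n := iter n step (B0 `|` range init).
have lvlS n : lvl n `<=` <<s B0 >>.
  elim: n => [|n IH] A.
    by move=> [|[k _ <-]]; [exact: sub_sigma_algebra|exact: initS].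
  move=> [[D lD]|[k _ [D lD [E lE <-]]]].
    by have [_ _ + _] := gBC D (IH _ lD); apply.
  by apply: opS; exact: IH.
have lvlC n : countable (lvl n).
  elim: n => [|n IH].
    apply: countableU; last exact: countable_range_nat.
    by have [] := g0.
  apply: countableU; first apply: bigcup_countable => // A lA.
    by have [[]] := gBC A (lvlS _ _ lA).
  apply: bigcup_countable => // k _; apply: bigcup_countable => // A lA.
  exact: sub_countable (card_image_le _ _) IH.
have lvlW n A : lvl n A -> lvl n.+1 A.
  by move=> lA; left; exists A => //; have [] := gBC A (lvlS _ _ lA).
have lvlM n m A : (n <= m)%N -> lvl n A -> lvl m A.
  by move=> /subnK <-; elim: (m - n)%N => // k IH /IH/lvlW.
pose B := \bigcup_n lvl n.
have BS : B `<=` <<s B0 >> by move=> A [n _ /lvlS].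
have BE : B = \bigcup_(A in B) BB A.
  apply/seteqP; split=> [A BA|A [D [n _ lD] BDA]].
    by exists A => //; have [] := gBC A (BS _ BA).
  by exists n.+1 => //; left; exists D.
exists B, (\bigcup_(A in B) CC A); split => //.
- rewrite {1}BE; apply: (@good_bigcup _ B B0) => //.
  + exact: bigcup_countable.
  + by exists (init 0%N), 0%N => //; right; exists 0%N.
  + by move=> A BA; have [] := gBC A (BS _ BA).
  + by move=> A BA; have [] := gBC A (BS _ BA).
- by move=> A B0A; exists 0%N => //; left.
- by move=> n; exists 0%N => //; right; exists n.
move=> k A A' [n _ lA] [m _ lA']; exists (maxn n m).+1 => //; right.
exists k => //; exists A; first exact: lvlM (leq_maxl _ _) lA.
by exists A' => //; exact: lvlM (leq_maxr _ _) lA'.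
Qed.

End good_families.

(** * Baire category in the fibres *)

(** Baire's theorem: shrinking open sets, each with closure in the previous one and inside a member
    of the next cover, lie in a convergent ultrafilter, and the closures retain its limit. *)
Lemma polish_opens_baire {Y : Type} (op : set (set Y)) (N : nat -> set Y) :
  setI_closed op -> polish_opens op ->
  (forall k V, op V -> V !=set0 ->
    exists V', [/\ op V', V' !=set0, V' `<=` V & V' `<=` ~` N k]) ->
  forall V, op V -> V !=set0 -> exists x, V x /\ forall k, ~ N k x.
Proof.
move=> opI [_ regY _ [r [ro rcover cr]]] nwdN V oV V0.
pose good k (V V' : set Y) := [/\ op V', V' !=set0, V' `<=` ~` N k,
  exists j, V' `<=` r k j & exists W, [/\ op W, V' `<=` ~` W & ~` W `<=` V]].
have [step stepP] : exists step : nat -> set Y -> set Y,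
    forall k V, op V /\ V !=set0 -> good k V (step k V).
  suff /choice[f fP] : forall kV : nat * set Y, exists V',
      op kV.2 /\ kV.2 !=set0 -> good kV.1 kV.2 V'.
    by exists (fun k V => f (k, V)) => k V' /(fP (k, V')).
  move=> [k V1]; have [[oV1 V10]|nV1] := pselect (op V1 /\ V1 !=set0); last first.
    by exists set0.
  have [V2 [oV2 [x V2x] V21 V2N]] := nwdN k _ oV1 V10.
  have [j rx] := rcover k x.
  have [V3 [W [oV3 oW V3x V3W WV2]]] := regY _ x (opI _ _ oV2 (ro k j)) (conj V2x rx).
  exists V3 => _; split => //; first by exists x.
  - by apply: subset_trans V2N => y /V3W/WV2[].
  - by exists j => y /V3W/WV2[].
  - by exists W; split => // y /WV2[/V21].
pose W k := iteri k step V.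
have WP k : op (W k) /\ W k !=set0.
  by elim: k => // k IH; have [] := stepP k _ IH.
have Wgood k := stepP k _ (WP k).
have WS k : W k.+1 `<=` W k.
  by have [_ _ _ _ [Q [_ h1 h2]]] := Wgood k; exact: subset_trans h2.
have Wmono i j : (i <= j)%N -> W j `<=` W i.
  by move=> /subnK <-; elim: (j - i)%N => // k IH; exact: subset_trans (WS _) IH.
have pF : ProperFilter (filter_from setT W).
  apply: filter_from_proper; last by move=> k _; have [] := WP k.
  apply: filter_from_filter; first by exists 0%N.
  move=> i j _ _; exists (maxn i j) => // x Wx.
  by split; [exact: (Wmono _ _ (leq_maxl i j))|exact: (Wmono _ _ (leq_maxr i j))].
have [F [FU WF]] := ultraFilterLemma pF.
have FW k : F (W k) by apply: WF; exists k.
have [|x Fx] := cr F FU.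
  move=> k; have [_ _ _ [j Wr] _] := Wgood k.
  by exists j; exact: filterS Wr (FW k.+1).
have Wx k : W k x.
  have [_ _ _ _ [Q [oQ WQ QW]]] := Wgood k; apply: QW => /(Fx _ oQ) FQ.
  exact: (ultra_not (FW k.+1) FQ WQ).
exists x; split; first exact: (Wx 0%N).
by move=> k; have [_ _ h _ _] := Wgood k; exact: (h _ (Wx k.+1)).
Qed.

Lemma sigma_algebra_setI {T : Type} (S : set (set T)) :
  sigma_algebra setT S -> setI_closed S.
Proof.
move=> [S0 SC SU] A B SA SB; rewrite -[A `&` B]setCK setCI -!setTD; apply: (SC).
rewrite -bigcup2E; apply: SU => -[|[|n]] /=; [exact: SC|exact: SC|exact: S0].
Qed.

(* Category notions relative to a subset [F] of a space with base [U];
   [F] is a fibre of the source map in the application. *)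
Section relative_category.
Context {T : Type} (U : nat -> set T).
Implicit Types (F M N A : set T).

Definition is_base := forall i j x, U i x -> U j x ->
  exists k, [/\ U k x, U k `<=` U i & U k `<=` U j].

Definition meets_fibre F n := exists g, F g /\ U n g.

Definition nowhere_dense F N := forall n, meets_fibre F n ->
  exists m, [/\ meets_fibre F m, U m `<=` U n & forall g, F g -> U m g -> ~ N g].

Definition meager F M := exists N : nat -> set T,
  (forall k, nowhere_dense F (N k)) /\
  forall g, F g -> M g -> exists k, N k g.

Lemma meager_sub F M M' : (forall g, F g -> M g -> M' g) -> meager F M' -> meager F M.
Proof.
by move=> MM' [N [nwdN M'N]]; exists N; split => // g Fg Mg; apply: M'N => //; exact: MM'.
Qed.

Lemma meager_disjoint F M : (forall g, F g -> ~ M g) -> meager F M.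
Proof.
move=> FM; exists (fun=> set0); split; last by move=> g Fg /(FM _ Fg).
by move=> _ n Fn; exists n; split => // g _ _.
Qed.

Lemma nowhere_dense_meager F N : nowhere_dense F N -> meager F N.
Proof. by move=> nwdN; exists (fun=> N); split => // g _ Ng; exists 0%N. Qed.

Lemma meager_bigcup F (M : nat -> set T) :
  (forall k, meager F (M k)) -> meager F (\bigcup_k M k).
Proof.
move=> /choice[N MN].
exists (fun n => if unpickle n is Some (k, l) then N k l else set0); split.
  move=> n; case: unpickle => [[k l]|]; first exact: (MN k).1.
  by move=> m Fm; exists m; split => // g _ _.
move=> g Fg [k _ Mkg]; have [l Nlg] := (MN k).2 g Fg Mkg.
by exists (pickle (k, l)); rewrite pickleK.
Qed.

Lemma meagerU F M M' : meager F M -> meager F M' -> meager F (M `|` M').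
Proof.
move=> mM mM'; rewrite -bigcup2E; apply: meager_bigcup => -[|[|k]] //=.
by apply: meager_disjoint => g _ [].
Qed.

Definition baire_fibre F := forall n, meets_fibre F n -> ~ meager F (U n).

Lemma not_meager_ex F M : ~ meager F M -> exists g, F g /\ M g.
Proof.
move=> nM; apply: contrapT => FM; apply: nM; apply: meager_disjoint => g Fg Mg.
by apply: FM; exists g.
Qed.

(* For sets with the Baire property, nonmeager means comeager somewhere. *)
Definition baire_property F A := forall n, ~ meager F (U n `&` A) ->
  exists m, [/\ meets_fibre F m, U m `<=` U n & meager F (U m `\` A)].

Lemma baire_property_eq F A A' : (forall g, F g -> (A g <-> A' g)) ->
  baire_property F A -> baire_property F A'.
Proof.
move=> AA' bpA n nm; have [|m [Fm mn mA]] := bpA n.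
  by apply: contra_not nm; apply: meager_sub => g Fg [Ug A'g]; split => //; apply/AA'.
exists m; split => //.
by apply: meager_sub mA => g Fg [Ug A'g]; split => // Ag; apply: A'g; exact/AA'.
Qed.

Lemma baire_property_bigcup F (A : nat -> set T) :
  (forall k, baire_property F (A k)) -> baire_property F (\bigcup_k A k).
Proof.
move=> bpA n nm.
have [k nmk] : exists k, ~ meager F (U n `&` A k).
  apply: contrapT => nk; apply: nm; rewrite setI_bigcupr; apply: meager_bigcup => k.
  by apply: contrapT => nmk; apply: nk; exists k.
have [m [Fm mn mA]] := bpA k n nmk; exists m; split => //.
by apply: meager_sub mA => g _ [Ug nA]; split => // Ag; apply: nA; exists k.
Qed.

Lemma baire_property_base F A : is_base ->
  (forall g, A g -> exists k, U k g /\ U k `<=` A) -> baire_property F A.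
Proof.
move=> baseU oA n /not_meager_ex[g [Fg [Ung /oA[k [Ukg kA]]]]].
have [m [Umg mn mk]] := baseU _ _ _ Ung Ukg.
exists m; split => //; first by exists g.
by apply: meager_disjoint => h _ [/mk/kA].
Qed.

(** If the complement of [A] is comeager in no basic part of [U n], then the basic sets in which [A]
    is comeager have a union dense in [U n]. Their exceptional points are meager together, and what
    remains of [U n] is nowhere dense. *)
Lemma baire_propertyC F A : is_base -> baire_property F A -> baire_property F (~` A).
Proof.
move=> baseU bpA n nm; apply: contrapT => nex; apply: nm.
pose J m := U m `<=` U n /\ meager F (U m `\` A).
pose O m := [set g | J m /\ U m g].
apply: (@meager_sub _ _ ((\bigcup_m (O m `\` A)) `|` (U n `\` \bigcup_m O m))).
  move=> g _ [Ung nAg]; have [[m _ Omg]|nO] := pselect ((\bigcup_m O m) g).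
    by left; exists m.
  by right.
apply: meagerU.
  apply: meager_bigcup => m; have [[mn mA]|nJ] := pselect (J m).
    by apply: meager_sub mA => g _ [[_ Umg] nAg].
  by apply: meager_disjoint => g _ [[]].
apply: nowhere_dense_meager => k Fk.
have [[g [Fg [Ukg Ung]]]|nkn] := pselect (exists g, F g /\ (U k g /\ U n g)); last first.
  exists k; split => // g Fg Ukg [Ung _].
  by apply: nkn; exists g.
have [l [Ulg lk ln]] := baseU _ _ _ Ukg Ung.
have [|m [Fm ml mA]] := bpA l.
  move=> mlA; apply: nex; exists l; split => //; first by exists g.
  by rewrite setDE setCK.
exists m; split => //; first exact: subset_trans lk.
move=> h Fh Umh [_]; apply; exists m => //; split => //; split => //.
exact: subset_trans ln.
Qed.

Lemma baire_property_sigma_algebra F : is_base -> sigma_algebra setT (baire_property F).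
Proof.
move=> baseU; split.
- by apply: baire_property_base.
- by move=> A bpA; rewrite setTD; exact: baire_propertyC.
- exact: baire_property_bigcup.
Qed.

Lemma meager_homeo F F' (f f' : T -> T) M : is_base ->
  (forall g, F g -> F' (f g)) -> (forall h, F' h -> F (f' h)) ->
  (forall g, F g -> f' (f g) = g) -> (forall h, F' h -> f (f' h) = h) ->
  (forall n g, F g -> U n (f g) ->
    exists m, U m g /\ forall g', F g' -> U m g' -> U n (f g')) ->
  (forall n h, F' h -> U n (f' h) ->
    exists m, U m h /\ forall h', F' h' -> U m h' -> U n (f' h')) ->
  meager F' M -> meager F (f @^-1` M).
Proof.
move=> baseU FF' F'F fK f'K cf cf' [N [nwdN MN]].
exists (fun k => f @^-1` N k); split; last first.
  by move=> g /FF' F'g /= /(MN _ F'g).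
move=> k n [g [Fg Ung]].
have [m [Umg mn]] := cf' n (f g) (FF' _ Fg) (eq_ind_r (U n) Ung (fK _ Fg)).
have [|l [[h [F'h Ulh]] lm lN]] := nwdN k m; first by exists (f g); split => //; exact: FF'.
have [i [Uih il]] := cf l (f' h) (F'F _ F'h) (eq_ind_r (U l) Ulh (f'K _ F'h)).
have [j [Ujh ji jn]] := baseU _ _ _ Uih (mn _ F'h (lm _ Ulh)).
exists j; split => //; first by exists (f' h); split => //; exact: F'F.
by move=> g' Fg' /ji/(il _ Fg') Ulg'; apply: lN => //; exact: FF'.
Qed.

End relative_category.

Lemma ultrafilterP {T : Type} (F : set_system T) : ProperFilter F ->
  (forall A, F A \/ F (~` A)) -> UltraFilter F.
Proof.
move=> pF FC; split => // G GP FG; apply/seteqP; split => // A GA.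
have [//|/FG GnA] := FC A.
have GAA : G (A `&` ~` A) by exact: filterI.
by have [x []] := filter_ex GAA.
Qed.

Lemma open_set_typeP (T : topologicalType) (A : set T) (V : set (set_type A)) :
  open V <-> exists2 W : set T, open W & forall a, V a <-> W (set_val a).
Proof.
split=> [[W oW <-]|[W oW VW]]; first by exists W.
by exists W => //; apply/seteqP; split => a /VW.
Qed.

Lemma open_prodP (T T' : topologicalType) (W : set (T * T')) :
  open W <-> forall x y, W (x, y) -> exists A B,
    [/\ open A, open B, A x, B y & forall x' y', A x' -> B y' -> W (x', y')].
Proof.
rewrite openE; split=> [oW x y /oW|oW [x y] /oW[A [B [oA oB Ax By AB]]]].
  case=> [[A B] /= [+ +] AB]; rewrite !nbhsE => -[A' [oA' A'x] AA'] [B' [oB' B'y] BB'].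
  by exists A', B'; split => // x' y' /AA' Ax' /BB' By'; exact: (AB (x', y')).
exists (A, B) => /=; last by case=> x' y' /= [/AB]; apply.
by split; apply: open_nbhs_nbhs.
Qed.

(** * Topology of a Polish groupoid *)

Section groupoid_topology.
Context {R : realType} {G : topologicalType} {gpd : groupoid G}.
Hypothesis hG : polish_groupoid R gpd.
Implicit Types (g h : G) (V W : set G).

Local Notation src := (src gpd).
Local Notation rng := (rng gpd).
Local Notation mul := (gmul gpd).
Local Notation inv := (ginv gpd).

Lemma unit_rng g : units gpd (rng g).
Proof. exact: src_rng. Qed.

Lemma ginvK g : inv (inv g) = g.
Proof.
have e : src (inv (inv g)) = rng (inv g) by rewrite src_ginv.
rewrite -[LHS](gmul_src gpd) src_ginv rng_ginv -(gmulVg gpd).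
by rewrite gmulA ?src_ginv// gmulVg src_ginv gmul_rng.
Qed.

Lemma gmulgKV g h : src g = src h -> mul (mul g (inv h)) h = g.
Proof. by move=> gh; rewrite -gmulA ?rng_ginv ?src_ginv// gmulVg -gh gmul_src. Qed.

Lemma gmulgK g h : src g = rng h -> mul (mul g h) (inv h) = g.
Proof. by move=> gh; rewrite -gmulA ?rng_ginv// gmulgV -gh gmul_src. Qed.

Lemma gmul_nbhs g h W : src g = rng h -> open W -> W (mul g h) ->
  exists A B, [/\ open A, open B, A g, B h &
    forall g' h', A g' -> B h' -> src g' = rng h' -> W (mul g' h')].
Proof.
move=> gh oW Wgh; have /continuousP/(_ _ oW) := pg_mul_continuous hG.
move=> /open_set_typeP[Q /open_prodP oQ QW].
pose p g h (e : src g = rng h) : set_type (composable gpd) :=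
  SigSub (mem_set (e : composable gpd (g, h))).
have /oQ[A [B [oA oB Ag Bh AB]]] : Q (g, h) by exact: (QW (p g h gh)).1 Wgh.
exists A, B; split => // g' h' Ag' Bh' e.
have Qgh : Q (set_val (p g' h' e)) by exact: AB.
exact: (QW (p g' h' e)).2 Qgh.
Qed.

Lemma open_ginv W : open W -> open (inv @^-1` W).
Proof. by move: W; apply/continuousP; exact: pg_inv_continuous hG. Qed.

Lemma open_src W : open W -> open (src @^-1` W).
Proof.
move=> oW; rewrite openE => g Wg.
have [|A [B [oA oB Ag Bg AB]]] := @gmul_nbhs (inv g) g W (src_ginv _ g) oW.
  by rewrite gmulVg.
rewrite /interior nbhsE; exists (inv @^-1` A `&` B).
  by split => //; apply: openI => //; exact: open_ginv.
by move=> h [Ah Bh]; rewrite /= -(gmulVg gpd); apply: AB; rewrite ?src_ginv.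
Qed.

(** Openness of the source map comes from openness of multiplication: a unit of the form $g h$ with
    $h$ in [W] is the source of $h$. *)
Lemma src_image W : open W -> exists2 W', open W' &
  forall x, units gpd x -> (W' x <-> exists2 g, W g & src g = x).
Proof.
move=> oW; pose V : set (set_type (composable gpd)) :=
  [set a | W (set_val a).2].
have oV : open V.
  apply/open_set_typeP; exists [set gh | W gh.2] => //.
  by apply/open_prodP => g h Wh; exists setT, W; split => //; exact: openT.
exists (composition (gpd := gpd) @` V); first exact: pg_mul_open hG _ oV.
move=> x ux; split=> [[[gh e] Wh ghx]|[g Wg gx]]; last first.
  pose a : set_type (composable gpd) :=
    SigSub (mem_set (src_ginv gpd g : composable gpd (inv g, g))).
  by exists a => //; rewrite /composition /= gmulVg.
exists gh.2; first exact: Wh.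
have srcE := src_gmul (set_mem e : src gh.1 = rng gh.2).
rewrite -srcE -[mul _ _]/(composition (exist _ gh e)) ghx; exact: ux.
Qed.

(** Regularity is available on the space of units only, hence open sets of arrows compared on
    units. *)
Lemma unit_regular W x : open W -> units gpd x -> W x ->
  exists V V', [/\ open V, open V', V x, forall y, units gpd y -> V y -> ~ V' y &
    forall y, units gpd y -> ~ V' y -> W y].
Proof.
move=> oW ux Wx; have [_ regu _ _] := (polishP _ _).1 (pg_units_polish hG).
pose i y (uy : units gpd y) : set_type (units gpd) := SigSub (mem_set uy).
have [||V [V' [/open_set_typeP[A oA AV] /open_set_typeP[A' oA' AV']] Vx VV' V'W]] :=
  regu (set_val @^-1` W) (i x ux).
- by apply/open_set_typeP; exists W.
- exact: Wx.
exists A, A'; split => //.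
- exact: (AV (i x ux)).1 Vx.
- move=> y uy Ay A'y; apply: (VV' (i y uy)); first exact: (AV (i y uy)).2 Ay.
  exact: (AV' (i y uy)).2 A'y.
- by move=> y uy nA'y; apply: (V'W (i y uy)) => /AV'.
Qed.

Lemma unit_separated x y : units gpd x -> units gpd y -> x <> y ->
  exists V V', [/\ open V, open V', V x, V' y &
    forall z, units gpd z -> V z -> ~ V' z].
Proof.
move=> ux uy xy; have [sepu _ _ _] := (polishP _ _).1 (pg_units_polish hG).
pose i z (uz : units gpd z) : set_type (units gpd) := SigSub (mem_set uz).
have [|V [V' [/open_set_typeP[A oA AV] /open_set_typeP[A' oA' AV'] Vx V'y VV']]] :=
  sepu (i x ux) (i y uy).
  by move/(congr1 set_val).
exists A, A'; split => //; [exact: (AV (i x ux)).1 Vx|exact: (AV' (i y uy)).1 V'y|].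
move=> z uz Az A'z; apply: (VV' (i z uz)); first exact: (AV (i z uz)).2 Az.
exact: (AV' (i z uz)).2 A'z.
Qed.

(** Completeness of the subspace [V], phrased with ultrafilters on all of [G] so that no subtype
    appears in later arguments. *)
Definition local_covers (V : set G) (r : nat -> nat -> set G) :=
  [/\ forall m k, open (r m k), forall m g, V g -> exists k, r m k g &
   forall F, UltraFilter F -> F V -> (forall m, exists k, F (r m k)) ->
    exists g, V g /\ converges (@open G) F g].

Lemma polish_local_covers V : polish R (set_type V) ->
  exists r, local_covers V r.
Proof.
move=> /polishP[_ _ _ [r [ro rcover cr]]].
have /choice[s sP] : forall m, exists s : nat -> set G,
    forall k, open (s k) /\ forall a, r m k a <-> s k (set_val a).
  move=> m; have /choice[s sP] : forall k, exists s : set G,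
      open s /\ forall a, r m k a <-> s (set_val a).
    by move=> k; have /open_set_typeP[s os rs] := ro m k; exists s.
  by exists s.
pose i g (Vg : V g) : set_type V := SigSub (mem_set Vg).
exists s; split => [m k|m g Vg|F FU FV Fs]; first exact: (sP m k).1.
  by have [k rk] := rcover m (i g Vg); exists k; exact: ((sP m k).2 (i g Vg)).1 rk.
(* The trace of [F] on the subtype; quantifying over proofs of [V g] replaces a partial inverse of
   the inclusion. *)
pose F' : set_system (set_type V) :=
  [set A | F [set g | V g /\ forall Vg : V g, A (i g Vg)]].
have iE a Va : i (set_val a) Va = a by apply: val_inj.
have F'pre A : F A -> F' (set_val @^-1` A).
  by move=> FA; apply: filterS (filterI FV FA) => g [].
have F'E A : F' A -> F [set g | V g /\ forall Vg : V g, A (i g Vg)] by [].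
have F'I A : F [set g | V g /\ forall Vg : V g, A (i g Vg)] -> F' A by [].
have pF' : ProperFilter F'.
  apply: Build_ProperFilter_ex => [A /F'E/filter_ex[g [Vg Ag]]|].
    by exists (i g Vg).
  split; first by apply: F'I; apply: filterS FV => g Vg; split.
    move=> A A' /F'E FA /F'E FA'; apply: F'I.
    apply: filterS (filterI FA FA') => g [[Vg Ag] [_ A'g]].
    by split.
  move=> A A' AA' /F'E FA; apply: F'I; apply: filterS FA => g [Vg Ag].
  by split => // Vg'; apply: AA'; exact: Ag.
have F'U : UltraFilter F'.
  apply: ultrafilterP => // A.
  have [FA|FA] := in_ultra_setVsetC [set g | V g /\ forall Vg : V g, A (i g Vg)] FU.
    by left.
  right; apply: F'I; apply: filterS (filterI FV FA) => g [Vg nA].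
  split => // Vg' Ag; apply: nA; split => // Vg''.
  by rewrite (Prop_irrelevance Vg'' Vg').
have [m|a F'a] := cr F' F'U.
  have [k Fk] := Fs m; exists k; apply: (@filterS _ F' _ _ _ _ (F'pre _ Fk)) => a.
  exact: ((sP m k).2 a).2.
exists (set_val a); split; first exact: set_valP.
move=> W oW Wa.
have F'W : F' (set_val @^-1` W) by apply: F'a => //; apply/open_set_typeP; exists W.
by apply: filterS (F'E _ F'W) => g [Vg /(_ Vg)].
Qed.

Lemma groupoid_base : exists U : nat -> set G, open_base (@open G) U /\
  forall n, exists r, local_covers (U n) r.
Proof.
have [B [cB [Bo Bbase] Bpol]] := pg_locally_polish hG.
have [U [BU UB]] := countable_enum set0 cB.
exists U; split; first split.
- by move=> n; have [/Bo//|->] := UB _ (imageT U n); exact: open0.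
- move=> W x oW Wx; have [A [BA Ax] AW] := Bbase x _ (open_nbhs_nbhs (conj oW Wx)).
  by have [n _ Un] := BU _ BA; exists n; rewrite Un.
move=> n; have [/Bpol/polish_local_covers//|->] := UB _ (imageT U n).
exists (fun _ _ => set0); split => [_ _|//|F FU F0]; first exact: open0.
by have [] := filter_ex F0.
Qed.

Lemma src_fibre_baire U x : open_base (@open G) U -> units gpd x ->
  baire_fibre U [set g | src g = x].
Proof.
move=> [oU baseU] ux n [g [gx Ung]] [N [nwdN UN]].
have poF := (polishP _ _).1 (pg_src_polish hG ux).
pose i h (hx : src h = x) : set_type [set g | src g = x] := SigSub (mem_set hx).
have nwdN' k (Q : set (set_type [set g | src g = x])) : open Q -> Q !=set0 ->
    exists Q', [/\ open Q', Q' !=set0, Q' `<=` Q & Q' `<=` ~` (set_val @^-1` N k)].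
  move=> /open_set_typeP[W oW QW] [a Qa].
  have [m [Uma mW]] := baseU _ _ oW ((QW a).1 Qa).
  have [|l [[h [hx Ulh]] lm lN]] := nwdN k m.
    by exists (set_val a); split => //; exact: set_valP.
  exists (set_val @^-1` U l); split.
  + by apply/open_set_typeP; exists (U l).
  + by exists (i h hx).
  + by move=> b /lm/mW/QW.
  + by move=> b Ulb; apply: lN => //; exact: set_valP.
have [||a [Una nNa]] :=
    polish_opens_baire (@openI _) poF nwdN' (V := set_val @^-1` U n).
- by apply/open_set_typeP; exists (U n).
- by exists (i g gx).
by have [k Nka] := UN (set_val a) (set_valP a) Una; exact: nNa Nka.
Qed.

End groupoid_topology.

Lemma open_base_is_base (T : topologicalType) (U : nat -> set T) :
  open_base (@open T) U -> is_base U.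
Proof.
move=> [oU baseU] i j x Uix Ujx.
have [k [Ukx kij]] := baseU _ x (openI (oU i) (oU j)) (conj Uix Ujx).
by exists k; split => // y /kij[].
Qed.

(** * Vaught transforms and their measurability *)

Section vaught.
Context {R : realType} {G : topologicalType} {gpd : groupoid G}.
Hypothesis hG : polish_groupoid R gpd.
Variable U : nat -> set G.
Hypothesis baseU : open_base (@open G) U.
Context {X : Type} (a : gspace gpd X).
Implicit Types (A : set X) (V : set G) (g h : G) (x : X).

Local Notation src := (src gpd).
Local Notation rng := (rng gpd).
Local Notation mul := (gmul gpd).
Local Notation inv := (ginv gpd).
Local Notation fibre e := [set g | src g = e].
Local Notation p x := (set_val (anchor a x)).

Let baseU' : is_base U := open_base_is_base baseU.

(** Right translation by [h] is a homeomorphism between source fibres, inverted by translation by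
    [inv h]. *)
Lemma meager_mulr h (M : set G) : meager U (fibre (src h)) M ->
  meager U (fibre (rng h)) [set g | M (mul g h)].
Proof.
have [oU bU] := baseU.
move=> mM; apply: (@meager_homeo _ U _ _ (mul^~ h) (mul^~ (inv h)) M baseU' _ _ _ _ _ _ mM).
- by move=> g /= gh; rewrite src_gmul.
- by move=> g /= gh; rewrite src_gmul ?src_ginv ?rng_ginv.
- by move=> g /= gh; rewrite gmulgK.
- by move=> g /= gh; rewrite gmulgKV.
- move=> n g /= gh Ugh; have [A [B [oA oB Ag Bh AB]]] := gmul_nbhs hG gh (oU n) Ugh.
  have [m [Umg mA]] := bU _ _ oA Ag; exists m; split => // g' g'h /mA Ag'.
  exact: AB.
- move=> n g /= gh Ugh; have gh' : src g = rng (inv h) by rewrite rng_ginv.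
  have [A [B [oA oB Ag Bh AB]]] := gmul_nbhs hG gh' (oU n) Ugh.
  have [m [Umg mA]] := bU _ _ oA Ag; exists m; split => // g' g'h /mA Ag'.
  by apply: AB => //; rewrite rng_ginv.
Qed.

(* Vaught's transform $A^{\Delta V}$. *)
Definition vaught A V : set X :=
  [set x | ~ meager U (fibre (p x)) (V `&` [set g | A (act a g x)])].

(** Translation by [h] turns arrows acting on $h x$ into arrows acting on $x$; transforms at two
    points of an orbit are compared this way. *)
Lemma vaught_act A V V' h x : src h = p x -> vaught A V (act a h x) ->
  (forall k, V k -> src k = rng h -> V' (mul k h)) -> vaught A V' x.
Proof.
move=> hx; rewrite /vaught /= anchor_act// => nm VV'; apply: contra_not nm.
rewrite -hx => /meager_mulr; apply: meager_sub => k /= kh [Vk Akhx].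
by split; [exact: VV'|rewrite /= -act_gmul].
Qed.

Lemma act_inv h x : src h = p x -> act a (inv h) (act a h x) = x.
Proof. by move=> hx; rewrite act_gmul ?src_ginv// gmulVg hx act_anchor. Qed.

Lemma vaught_ex A V x : vaught A V x ->
  exists g, [/\ src g = p x, V g & A (act a g x)].
Proof. by move=> /not_meager_ex[g [gx [Vg Ag]]]; exists g. Qed.

Lemma vaught_sub A A' V V' x : vaught A V x ->
  (forall g, src g = p x -> V g -> A (act a g x) -> V' g /\ A' (act a g x)) ->
  vaught A' V' x.
Proof.
move=> nm sub; apply: contra_not nm; apply: meager_sub => g gx [Vg Ag].
exact: sub.
Qed.

Lemma open_not_meager V x g : open V -> V g -> src g = p x ->
  ~ meager U (fibre (p x)) V.
Proof.
have [_ bU] := baseU.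
move=> oV Vg gx mV; have [n [Ung nV]] := bU _ _ oV Vg.
have ux : units gpd (p x) by exact: set_valP.
have Fn : meets_fibre U (fibre (p x)) n by exists g.
by apply: (src_fibre_baire hG baseU ux Fn); apply: meager_sub mV => h _ /nV.
Qed.

Lemma vaught_of_comeager A V x g : open V -> V g -> src g = p x ->
  ~ vaught (~` A) V x -> vaught A V x.
Proof.
move=> oV Vg gx /contrapT mC mA; apply: (open_not_meager oV Vg gx).
apply: meager_sub (meagerU mC mA) => h _ Vh.
by have [Ah|nAh] := pselect (A (act a h x)); [right|left].
Qed.

Section measurability.
Variable S : set (set X).
Hypothesis hX : borel_gspace R S a.
Hypothesis salgS : sigma_algebra setT S.

Lemma meets_fibre_measurable V : open V -> S [set x | exists g, src g = p x /\ V g].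
Proof.
have [_ anchorS _] := hX.
move=> oV; have [W oW WV] := src_image hG oV.
rewrite (_ : [set _ | _] = anchor a @^-1` (set_val @^-1` W)).
  by apply: anchorS; apply: sub_sigma_algebra; apply/open_set_typeP; exists W.
apply/seteqP; split => x /=.
  by move=> [g [gx Vg]]; apply/WV; [exact: set_valP|exists g].
by move/WV => /(_ (set_valP _))[g Vg gx]; exists g.
Qed.

(** The Baire property of the sections is carried along for the complement step: a complement is
    nonmeager in [U n] exactly when the set itself is meager in some [U m] inside [U n] that meets
    the fibre. *)
Definition category_measurable (W : set (G * X)) :=
  (forall n, S [set x | ~ meager U (fibre (p x)) (U n `&` [set g | W (g, x)])]) /\
  forall x, baire_property U (fibre (p x)) [set g | W (g, x)].

Let SI : setI_closed S := sigma_algebra_setI salgS.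

Let S_bigcup_if (P : nat -> Prop) (A : nat -> set X) : (forall n, S (A n)) ->
  S (\bigcup_(n in P) A n).
Proof.
have [S0 _ SU] := salgS.
move=> SA; rewrite bigcup_mkcond; apply: SU => n; case: ifP => // _; exact: S0.
Qed.

(* Montgomery-Novikov. *)
Lemma category_measurable_sigma_algebra : sigma_algebra setT category_measurable.
Proof.
have [S0 SC SU] := salgS.
split.
- split=> [n|x]; last by apply: baire_property_base.
  rewrite (_ : [set _ | _] = set0)//; apply/seteqP; split => // x /=; apply.
  by apply: meager_disjoint => g _ [].
- move=> W [SW bpW]; rewrite setTD; split=> [n|x]; last first.
    exact: baire_propertyC (bpW x).
  rewrite (_ : [set _ | _] = \bigcup_(m in [set m | U m `<=` U n])
    ([set x | exists g, src g = p x /\ U m g] `&`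
     (setT `\` [set x | ~ meager U (fibre (p x)) (U m `&` [set g | W (g, x)])]))).
    apply: S_bigcup_if => m; apply: SI; last exact: SC.
    by apply: meets_fibre_measurable; have [] := baseU.
  apply/seteqP; split=> [x /= nm|x [m mn [[g [gx Umg]] [_ /contrapT mW]]] mnW].
    have [m [Fm mn]] := @baire_propertyC _ U _ _ baseU' (bpW x) n nm.
    rewrite setDE setCK => mW; exists m => //; split; first by [].
    by split => //; apply.
  have [oU _] := baseU; apply: (open_not_meager (oU m) Umg gx).
  apply: meager_sub (meagerU mW mnW) => h _ Umh.
  by have [Wh|nWh] := pselect (W (h, x)); [left|right; split => //; exact: mn].
- move=> W SW; split=> [n|x]; last first.
    rewrite (_ : [set g | (\bigcup_k W k) (g, x)] = \bigcup_k [set g | W k (g, x)]).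
      by apply: baire_property_bigcup => k; exact: (SW k).2.
    by apply/seteqP; split => g [k]; exists k.
  rewrite (_ : [set _ | _] = \bigcup_k
    [set x | ~ meager U (fibre (p x)) (U n `&` [set g | W k (g, x)])]).
    by apply: SU => k; exact: (SW k).1.
  apply/seteqP; split=> [x /= nm|x [k _ nm] m]; last first.
    by apply: nm; apply: meager_sub m => g _ [Ung Wg]; split => //; exists k.
  apply: contrapT => nx; apply: nm.
  rewrite (_ : _ `&` _ = \bigcup_k (U n `&` [set g | W k (g, x)])).
    by apply: meager_bigcup => k; apply: contrapT => nmk; apply: nx; exists k.
  apply/seteqP; split=> [g [Ung [k _ Wg]]|g [k _ [Ung Wg]]]; first by exists k.
  by split => //; exists k.
Qed.

Lemma prod_borel_category_measurable : prod_borel (borel G) S `<=` category_measurable.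
Proof.
have csa := category_measurable_sigma_algebra; have [c0 cC cU] := csa.
have [oU bU] := baseU.
apply: smallest_sub => // _ [[D bD <-]|[E SE <-]]; rewrite setTI.
  pose P := [set D : set G | category_measurable (fst @^-1` D)].
  suff : borel G `<=` P by apply.
  apply: smallest_sub.
    split=> [|D' PD'|D' PD']; first exact: c0.
      exact: (cC _ PD').
    exact: (cU _ PD').
  move=> D' oD'; split=> [n|x]; last first.
    apply: baire_property_base => // g /= D'g.
    by have [k [Ukg kD]] := bU _ _ oD' D'g; exists k.
  rewrite (_ : [set _ | _] = [set x | exists g, src g = p x /\ (U n `&` D') g]).
    by apply: meets_fibre_measurable; exact: openI.
  apply/seteqP; split=> [x /not_meager_ex[g [gx []]]|x [g [gx Dg]]]; first by exists g.
  exact: (open_not_meager (openI (oU n) oD') Dg gx).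
split=> [n|x]; last first.
  apply: baire_property_base => // g /= Eg.
  by have [k [Ukg _]] := bU _ _ openT (I : setT g); exists k; split => // h _.
rewrite (_ : [set _ | _] = E `&` [set x | exists g, src g = p x /\ U n g]).
  by apply: SI => //; exact: meets_fibre_measurable.
apply/seteqP; split=> [x /not_meager_ex[g [gx [Ung Ex]]]|x [Ex [g [gx Ung]]]].
  by split => //; exists g.
rewrite /= => mE; apply: (open_not_meager (oU n) Ung gx).
exact: meager_sub mE.
Qed.

Lemma action_category A : S A -> (forall n, S (vaught A (U n))) /\
  forall x, baire_property U (fibre (p x)) [set g | A (act a g x)].
Proof.
have [_ _ actS] := hX.
move=> /actS[W /prod_borel_category_measurable[SW bpW]]; rewrite setTI => WA.
have E g x : src g = p x -> (W (g, x) <-> A (act a g x)).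
  move=> gx; pose y : set_type (fibre_product a) :=
    SigSub (mem_set (gx : fibre_product a (g, x))).
  by rewrite -[W _]/((set_val @^-1` W) y) WA.
split=> [n|x]; last by apply: baire_property_eq (bpW x) => g; exact: E.
rewrite (_ : vaught A (U n) =
  [set x | ~ meager U (fibre (p x)) (U n `&` [set g | W (g, x)])])//.
apply/seteqP; split=> x; apply: contra_not; apply: meager_sub => g gx [Ung ?];
  by split => //; exact/(E g x gx).
Qed.

End measurability.

End vaught.

(** * Complete open images *)

Section open_image.
Context {Y Z : Type} (op : set (set Y)) (b : nat -> set Y).
Hypotheses (opT : op setT) (op0 : op set0).
Hypothesis opU : forall W : nat -> set Y, (forall n, op (W n)) -> op (\bigcup_n W n).
Hypotheses (regop : regular_opens op) (baseb : open_base op b).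
Variables (f : Z -> Y) (D : set Z) (r : nat -> nat -> set Z).

Fixpoint branch (s : seq nat) : set Z :=
  if s is k :: s then r (size s) k `&` branch s else D.

Hypothesis rcover : forall n z, D z -> exists k, r n k z.
Hypothesis fsurj : forall y, exists2 z, D z & f z = y.
Hypothesis fopen : forall s, op (f @` branch s).
(** [Z] has no topology, and convergence is asked only after pushing forward along [f]. In the
    application the limiting point of the orbit is not shown to be generic. *)
Hypothesis rcvg : forall F, UltraFilter F -> F D ->
  (forall n, exists k, F (r n k)) ->
  exists y, converges op [set A | F (f @^-1` A)] y.

(* [s] codes a node of the tree of finite intersections of the covers [r]; the
   row of the pair [(s, q)] forces an ultrafilter containing [b q], whose
   closure lies in the image of [s], to contain the image of a child of [s]. *)
Let shrinks s q W := [/\ op W, b q `<=` ~` W & ~` W `<=` f @` branch s].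

Let child s i := [set y | b i y /\ exists j W, shrinks (j :: s) i W].

Let branchW s z : branch s z -> D z.
Proof. by elim: s => // k s IH [_ /IH]. Qed.

(** An ultrafilter containing an image of some [r n k] for each [n] need not lift, because images do
    not commute with intersections. Hence the images of whole nodes are forced successively along a
    path of the tree, and the path makes the lift possible. *)
Lemma open_image_covers : exists R, complete_covers op R.
Proof.
have [ob bbase] := baseb.
have shrink y W : op W -> W y ->
    exists q V, [/\ b q y, op V, b q `<=` ~` V & ~` V `<=` W].
  move=> oW Wy; have [V [V' [oV oV' Vy VV' V'W]]] := regop oW Wy.
  have [q [bqy qV]] := bbase _ _ oV Vy.
  by exists q, V'; split => //; exact: subset_trans VV'.
have /choice[w wP] : forall sq : seq nat * nat, exists W,
    (exists W', shrinks sq.1 sq.2 W') -> shrinks sq.1 sq.2 W.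
  move=> [s q]; have [[W sW]|nW] := pselect (exists W, shrinks s q W).
    by exists W.
  by exists set0 => h; case: nW.
(* Index [0] is an open set disjoint from [b q] that contains all points outside the image of the
   node, so the children need only cover that image. *)
pose row (s : seq nat) (q k : nat) : set Y :=
  if pselect (exists W, shrinks s q W) is left _ then
    if k is m.+1 then \bigcup_(i in [set i | (i < m)%N]) child s i else w (s, q)
  else setT.
(* Row [0] is the base itself; it supplies [b q0], from which the path starts at the root. *)
pose R n k := if n is n.+1 then
  if unpickle n is Some (s, q) then row s q k else setT else b k.
have oR n k : op (R n k).
  case: n => [|n]; first exact: ob.
  rewrite /R; case: unpickle => [[s q]|] //; rewrite /row.
  case: pselect => // sW; case: k => [|m]; first by have [] := wP (s, q) sW.
  rewrite bigcup_mkcond; apply: opU => i; case: ifP => // _.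
  have [h|h] := pselect (exists j W, shrinks (j :: s) i W).
    rewrite (_ : child s i = b i)//; apply/seteqP; split=> y //; first by case.
  by rewrite (_ : child s i = set0)//; apply/seteqP; split=> y // [].
exists R; split => //.
  move=> [|n] y; first by have [k [bky _]] := bbase _ y opT I; exists k.
  rewrite /R; case: unpickle => [[s q]|]; last by exists 0%N.
  rewrite /row; case: pselect => [sW|]; last by exists 0%N.
  have [_ _ wb] := wP (s, q) sW.
  have [wy|/wb[z sz zy]] := pselect (w (s, q) y); first by exists 0%N.
  have [j rj] := rcover (size s) (branchW sz).
  have fy : (f @` branch (j :: s)) y by exists z.
  have [i [V [biy oV iV Vf]]] := shrink _ _ (fopen (j :: s)) fy.
  (* One successor skips index [0]; the other is there because the union runs strictly below its
     bound. *)
  by exists i.+2, i => //=; split => //; exists j, V.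
move=> F FU FR.
pose ok (sq : seq nat * nat) := F (b sq.2) /\ exists W, shrinks sq.1 sq.2 W.
have [q0 Fq0] := FR 0%N.
have ok0 : ok ([::], q0).
  split => //; exists set0; split => //; first by move=> y _ [].
  by move=> y _; have [z Dz zy] := fsurj y; exists z.
have /choice[nxt nxtP] : forall sq, exists jq : nat * nat,
    ok sq -> ok (jq.1 :: sq.1, jq.2).
  move=> [s q]; have [[Fq sW]|nok] := pselect (ok (s, q)); last first.
    by exists (0%N, 0%N).
  have [k] := FR (pickle (s, q)).+1; rewrite /R pickleK /row.
  case: pselect => // sW'; have [_ qw _] := wP (s, q) sW'.
  case: k => [Fw|m /ultra_bigcup_lt[i Fi]]; first by have := ultra_not Fq Fw qw.
  have [y [_ [j [W jW]]]] := filter_ex Fi.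
  exists (j, i) => _; split; last by exists W.
  by apply: filterS Fi => z [].
pose st n := iter n (fun sq => let jq := nxt sq in (jq.1 :: sq.1, jq.2)) ([::], q0).
have okst n : ok (st n) by elim: n => // n IH; exact: nxtP.
have sizest n : size (st n).1 = n by elim: n => //= n ->.
have stS n : branch (st n.+1).1 `<=` branch (st n).1 by move=> z [].
have stmono i j : (i <= j)%N -> branch (st j).1 `<=` branch (st i).1.
  by move=> /subnK <-; elim: (j - i)%N => // k IH; exact: subset_trans (stS _) IH.
(* A base of the lifted filter. It is nonempty: a member [A] of [F] meets the basic set attached to
   stage [n], which lies in the image of that node. *)
pose P (nA : nat * set Y) := branch (st nA.1).1 `&` f @^-1` nA.2.
have pF : ProperFilter (filter_from [set nA | F nA.2] P).
  apply: filter_from_proper; last first.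
    move=> [n A] /= FA; have [Fb [W [_ bW Wf]]] := okst n.
    have FAb : F (A `&` b (st n).2) by exact: filterI.
    have [y [Ay by_]] := filter_ex FAb.
    have [z sz zy] := Wf _ (bW _ by_).
    by exists z; split => //=; rewrite zy.
  apply: filter_from_filter; first by exists (0%N, setT); exact: filterT.
  move=> [n A] [m A'] /= FA FA'; exists (maxn n m, A `&` A'); first exact: filterI.
  move=> z [/= sz [Az A'z]]; split; split => //=.
    by apply: stmono sz; exact: leq_maxl.
  by apply: stmono sz; exact: leq_maxr.
have [H [HU PH]] := ultraFilterLemma pF.
have Hs n : H (branch (st n).1).
  by apply: PH; exists (n, setT) => [|z []//]; exact: filterT.
have HF A : F A -> H (f @^-1` A).
  by move=> FA; apply: PH; exists (0%N, A) => // z [].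
have [||y Hy] := rcvg HU.
- exact: (Hs 0%N).
- move=> n; exists (nxt (st n)).1; apply: filterS (Hs n.+1) => z.
  by rewrite /= sizest => -[].
exists y => W oW Wy; apply: contrapT => /ultra_setC/HF HnW.
have HW : H (f @^-1` W) by exact: Hy.
exact: (ultra_notC HW HnW).
Qed.

End open_image.

(** * The topology of Vaught transforms *)

Section vaught_topology.
Context {R : realType} {G : topologicalType} {gpd : groupoid G}.
Hypothesis hG : polish_groupoid R gpd.
Variable U : nat -> set G.
Hypothesis baseU : open_base (@open G) U.
Context {X : Type} (a : gspace gpd X) (S : set (set X)).
Hypothesis hX : borel_gspace R S a.
Hypothesis salgS : sigma_algebra setT S.
Variable BB : set (set X).
Hypotheses (BBS : BB `<=` S) (cBB : countable BB) (sepBB : separates_points BB).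
Hypotheses (BBT : BB setT) (BBC : forall A, BB A -> BB (~` A)).
Hypotheses (BBI : setI_closed BB).
Implicit Types (A B : set X) (V : set G) (g h : G) (x y : X).

Local Notation src := (src gpd).
Local Notation rng := (rng gpd).
Local Notation mul := (gmul gpd).
Local Notation inv := (ginv gpd).
Local Notation fibre e := [set g | src g = e].
Local Notation p x := (set_val (anchor a x)).
Local Notation vaught := (vaught U a).

Hypothesis BBV : forall A n, BB A -> BB (vaught A (U n)).
Hypothesis BBp : forall n, BB [set x | U n (p x)].

Let oU n : open (U n). Proof. exact: baseU.1. Qed.

Let bU V g : open V -> V g -> exists n, U n g /\ U n `<=` V.
Proof. exact: baseU.2. Qed.

Let unit_p x : units gpd (p x). Proof. exact: set_valP. Qed.

Let src_p x : src (p x) = p x. Proof. exact: unit_p. Qed.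

Let bpBB A x : BB A -> baire_property U (fibre (p x)) [set g | A (act a g x)].
Proof. by move=> /BBS SA; have [_] := action_category hG baseU hX salgS SA. Qed.

(* A point is generic when it lies in each [A] of [BB] containing it
   in a locally comeager way, as seen from the identity arrow. *)
Definition generic y := forall A, BB A -> A y ->
  exists n, U n (p y) /\ ~ vaught (~` A) (U n) y.

Lemma mul_unit_nbhs g V : open V -> V g -> exists m, U m (rng g) /\
  forall k, U m k -> src k = rng g -> V (mul k g).
Proof.
move=> oV Vg; have [||A [B [oA oB Ag Bg AB]]] := @gmul_nbhs _ _ _ hG (rng g) g V _ oV.
- by rewrite src_rng.
- by rewrite gmul_rng.
have [m [Um mA]] := bU oA Ag; exists m; split => // k Umk kg.
by apply: AB => //; exact: mA.
Qed.

(** For each of the countably many [A], the bad arrows lie in $E \setminus Q$, where [Q] is the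
    union of the [U n] in which [E] is comeager. Were this nonmeager, the Baire property would make
    it comeager in some [U m]; but then [U m] is part of [Q]. *)
Lemma generic_comeager x : meager U (fibre (p x)) [set g | ~ generic (act a g x)].
Proof.
have [b [BBb bBB]] := countable_enum set0 cBB.
have BB0 : BB set0 by rewrite -setCT; exact: BBC.
have bb k : BB (b k) by have [|->] := bBB _ (imageT b k).
pose N k := [set g | b k (act a g x) /\
  forall n, U n (rng g) -> vaught (~` b k) (U n) (act a g x)].
apply: (@meager_sub _ _ _ _ (\bigcup_k N k)).
  move=> g gx /= ngen; apply: contrapT => nN; apply: ngen => A BBA Agx.
  apply: contrapT => nn; apply: nN; have [k _ bk] := BBb _ BBA.
  exists k => //; split; rewrite bk // => n Un; apply: contrapT => nv; apply: nn.
  by exists n; rewrite anchor_act.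
apply: meager_bigcup => k; set A := b k.
pose Q := [set g | exists n, U n g /\ ~ vaught (~` A) (U n) x].
pose E := [set g | A (act a g x)].
have bpEQ : baire_property U (fibre (p x)) (E `&` ~` Q).
  have sa := baire_property_sigma_algebra (fibre (p x)) (open_base_is_base baseU).
  apply: (sigma_algebra_setI sa); first exact: bpBB (bb k).
  rewrite -setTD; case: (sa) => _ + _; apply.
  apply: baire_property_base; first exact: open_base_is_base.
  by move=> g [n [Ung nv]]; exists n; split => // h Unh; exists n.
apply: (@meager_sub _ _ _ _ (E `&` ~` Q)).
  move=> g gx [Agx vg]; split => // -[m [Umg nv]]; apply: nv.
  have [n [Ung nm]] := mul_unit_nbhs (oU m) Umg.
  exact: (vaught_act hG baseU (gx : src g = p x) (vg n Ung) nm).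
apply: contrapT => nm.
have [n nmn] : exists n, ~ meager U (fibre (p x)) (U n `&` (E `&` ~` Q)).
  apply: contrapT => nn; apply: nm.
  apply: (@meager_sub _ _ _ _ (\bigcup_n (U n `&` (E `&` ~` Q)))).
    by move=> g _ EQg; have [n [Ung _]] := bU openT (I : setT g); exists n.
  by apply: meager_bigcup => n; apply: contrapT => nmn; apply: nn; exists n.
have [m [[g [gx Umg]] mn mEQ]] := bpEQ n nmn.
have vm : ~ vaught (~` A) (U m) x.
  apply; apply: meager_sub mEQ => h hx [Umh nE].
  by split => // -[].
apply: (open_not_meager hG baseU (oU m) Umg gx); apply: meager_sub mEQ => h _ Umh.
by split => // -[_]; apply; exists m.
Qed.

Lemma generic_ex A V x : vaught A V x ->
  exists g, [/\ src g = p x, V g, A (act a g x) & generic (act a g x)].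
Proof.
move=> nm; apply: contrapT => ng; apply: nm.
apply: meager_sub (generic_comeager x) => g gx [Vg Ag] gen.
by apply: ng; exists g.
Qed.

Lemma vaughtT V x g : open V -> V g -> src g = p x -> vaught setT V x.
Proof.
move=> oV Vg gx mV; apply: (open_not_meager hG baseU oV Vg gx).
exact: meager_sub mV.
Qed.

Lemma generic_orbit x : exists g, src g = p x /\ generic (act a g x).
Proof.
have [g [gx _ _ gen]] := generic_ex (vaughtT (x := x) openT (I : setT (p x)) (src_p x)).
by exists g.
Qed.

(* Continuity of the map $(g, y) \mapsto g^{-1} y$. *)
Lemma vaught_nbhs A V x g : BB A -> open V -> vaught A V x -> src g = p x ->
  exists B n, [/\ BB B, U n g, B (act a g x) & forall g' x', src g' = p x' ->
    U n g' -> B (act a g' x') -> vaught A V x'].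
Proof.
move=> BBA oV nm gx.
(* Each [k] in [V] factors as $(k g^{-1}) g$, and continuity of multiplication gives it such a pair.
   Countability then fixes one pair serving nonmeagerly many [k]. *)
pose good i j := U j g /\ forall k l, U i k -> U j l -> src k = rng l -> V (mul k l).
pose M (ij : nat) : set G := if unpickle ij is Some (i, j)
  then [set k | [/\ good i j, U i (mul k (inv g)) & A (act a k x)]] else set0.
have [ij nmij] : exists ij, ~ meager U (fibre (p x)) (M ij).
  apply: contrapT => nij; apply: nm.
  apply: (@meager_sub _ _ _ _ (\bigcup_ij M ij)); last first.
    by apply: meager_bigcup => ij; apply: contrapT => nmij; apply: nij; exists ij.
  move=> k kx [Vk Akx].
  have kg : src (mul k (inv g)) = rng g.
    by rewrite src_gmul ?src_ginv// rng_ginv gx.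
  have kgg : mul (mul k (inv g)) g = k by rewrite gmulgKV// gx.
  have [|A1 [B1 [oA1 oB1 A1k B1g AB1]]] := gmul_nbhs hG kg oV; first by rewrite kgg.
  have [i [Uik iA]] := bU oA1 A1k; have [j [Ujg jB]] := bU oB1 B1g.
  exists (pickle (i, j)) => //; rewrite /M pickleK; split => //.
  by split => // k' l' /iA A1k' /jB B1l'; exact: AB1.
move: nmij; rewrite /M; case: unpickle => [[i j]|]; last first.
  by case; apply: meager_disjoint => k _ [].
move=> nmij; have [k [_ [[Ujg ijV] _ _]]] := not_meager_ex nmij.
have vB : vaught A (U i) (act a g x).
  apply: (@vaught_act _ _ _ hG _ baseU _ a A [set k | U i (mul k (inv g))] _ (inv g)) => //.
    by rewrite src_ginv anchor_act.
  rewrite act_inv//.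
  by apply: contra_not nmij; apply: meager_sub => k' _ [].
exists (vaught A (U i)), j; split => //; first exact: BBV.
by move=> g' x' gx' Ujg' vg'; apply: (vaught_act hG baseU gx' vg') => l Uil lg; exact: ijV.
Qed.

(* Openness of the same map on generic points. *)
Lemma generic_vaught B V x g : BB B -> B (act a g x) -> generic (act a g x) ->
  open V -> V g -> src g = p x -> vaught B V x.
Proof.
move=> BBB Bgx gen oV Vg gx; have [n [Un nvn]] := gen B BBB Bgx.
have [i [Uig iV]] := mul_unit_nbhs oV Vg.
rewrite anchor_act// in Un.
have [m [Umg min]] := bU (openI (oU i) (oU n)) (conj Uig Un).
have vm : vaught B (U m) (act a g x).
  apply: (vaught_of_comeager hG baseU (oU m) Umg); first by rewrite src_rng anchor_act.
  apply: contra_not nvn => vm; apply: vaught_sub vm _ => h _ Umh nB.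
  by split => //; have [] := min _ Umh.
by apply: (vaught_act hG baseU gx vm) => k /min[Uik _]; exact: iV.
Qed.

(** The transforms are declared a base, not a subbase; closure under intersection needs generic
    points. *)
Definition vaught_open_set : set (set X) := [set W | forall x, W x ->
  exists A n, [/\ BB A, vaught A (U n) x & vaught A (U n) `<=` W]].
Local Notation op := vaught_open_set.

Lemma vaught_open_nbhs (W : set X) x g : op W -> W x -> src g = p x ->
  exists B n, [/\ BB B, U n g, B (act a g x) & forall g' x', src g' = p x' ->
    U n g' -> B (act a g' x') -> W x'].
Proof.
move=> oW Wx gx; have [A [n [BBA vA vW]]] := oW x Wx.
have [B [m [BBB Umg Bg Bm]]] := vaught_nbhs BBA (oU n) vA gx.
by exists B, m; split => // g' x' gx' Umg' Bgx'; apply: vW; exact: Bm gx' _ _.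
Qed.

(** The quotient description: openness is tested upstairs, at generic points only. *)
Lemma vaught_open_generic (W : set X) : (forall x g, W x -> src g = p x -> generic (act a g x) ->
  exists B n, [/\ BB B, U n g, B (act a g x) & forall g' x', src g' = p x' ->
    U n g' -> B (act a g' x') -> W x']) -> op W.
Proof.
move=> oW x Wx; have [g [gx gen]] := generic_orbit x.
have [B [n [BBB Ung Bgx BW]]] := oW x g Wx gx gen.
exists B, n; split => //; first exact: generic_vaught (oU n) Ung gx.
by move=> x' vx'; have [g' [gx' Ung' Bgx']] := vaught_ex vx'; exact: BW gx' _ _.
Qed.

Lemma vaught_open_vaught A V : BB A -> open V -> op (vaught A V).
Proof.
by move=> BBA oV; apply: vaught_open_generic => x g vA gx _; exact: vaught_nbhs.
Qed.

Lemma vaught_open_setT : op setT.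
Proof.
apply: vaught_open_generic => x g _ gx _; have [n [Ung _]] := bU openT (I : setT g).
by exists setT, n.
Qed.

Lemma vaught_open_setI : setI_closed op.
Proof.
move=> W W' oW oW'; apply: vaught_open_generic => x g [Wx W'x] gx _.
have [B [n [BBB Ung Bgx BW]]] := vaught_open_nbhs oW Wx gx.
have [B' [n' [BBB' Ung' Bgx' BW']]] := vaught_open_nbhs oW' W'x gx.
have [m [Umg mn]] := bU (openI (oU n) (oU n')) (conj Ung Ung').
exists (B `&` B'), m; split => //; first exact: BBI.
by move=> g' x' gx' /mn[Ung1 Ung2] [Bg1 Bg2]; split; [exact: BW gx' _ _|exact: BW' gx' _ _].
Qed.

Lemma vaught_open_bigcup I (W : I -> set X) : (forall i, op (W i)) -> op (\bigcup_i W i).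
Proof.
move=> oW x [i _ Wix]; have [A [n [BBA vA vW]]] := oW i x Wix.
by exists A, n; split => // y /vW; exists i.
Qed.

Lemma vaught_open_anchor V : open V -> op [set x | V (p x)].
Proof.
move=> oV; have oV' := open_src hG oV.
apply: vaught_open_generic => x g Vx gx _.
have [n [Ung nV]] := bU oV' (eq_ind_r V Vx gx).
by exists setT, n; split => // g' x' gx' /nV; rewrite /= gx'.
Qed.

(** A generic point $g h x$ is reached from $h x$ by $g$. If $x'$ reaches [B] by some $g'$ near $g
    h$, then $h' x'$ reaches the same point by $g' h'^{-1}$, which is near $g$. *)
Lemma vaught_open_act (W : set X) h x : op W -> src h = p x -> W (act a h x) ->
  exists V W', [/\ open V, op W', V h, W' x &
    forall h' x', V h' -> W' x' -> src h' = p x' -> W (act a h' x')].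
Proof.
move=> oW hx Wx; have [g [gx gen]] := generic_orbit (act a h x).
have [B [n [BBB Ung Bgx BW]]] := vaught_open_nbhs oW Wx gx.
have gh : src g = rng h by rewrite gx anchor_act.
have ghh : mul (mul g h) (inv h) = g by rewrite gmulgK.
have gh' : src (mul g h) = rng (inv h) by rewrite src_gmul// rng_ginv.
have [|A1 [A2 [oA1 oA2 A1g A2h AU]]] := gmul_nbhs hG gh' (oU n); first by rewrite ghh.
have ghx : src (mul g h) = p x by rewrite src_gmul.
rewrite act_gmul// in gen Bgx.
exists (inv @^-1` A2), (vaught B A1); split => //.
- exact: open_ginv hG _ oA2.
- exact: vaught_open_vaught.
- exact: generic_vaught A1g ghx.
move=> h' x' A2h' vx' hx'; have [g' [gx' A1g' Bg']] := vaught_ex vx'.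
have hg' : src g' = rng (inv h') by rewrite rng_ginv gx'.
apply: (BW (mul g' (inv h'))).
- by rewrite src_gmul// src_ginv anchor_act.
- by apply: AU.
by rewrite -act_gmul ?act_inv// src_ginv anchor_act.
Qed.

(** With equal anchors, if every [E k] were meager, some arrow would send [x] and [y] to points in
    the same members of [BB], hence to one point. So some [E k] is comeager in a basic set [U m],
    and the transform of [b k] over [U m] separates. *)
Lemma vaught_open_T0 x y : x <> y -> exists W, op W /\ ((W x /\ ~ W y) \/ (W y /\ ~ W x)).
Proof.
move=> xy; have [pxy|pxy] := pselect (p x = p y); last first.
  have [V [V' [oV _ Vx V'y VV']]] := unit_separated hG (unit_p x) (unit_p y) pxy.
  exists [set x | V (p x)]; split; first exact: vaught_open_anchor.
  by left; split => // /(VV' _ (unit_p y)).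
have [b [BBb bBB]] := countable_enum set0 cBB.
have BB0 : BB set0 by rewrite -setCT; exact: BBC.
have bb k : BB (b k) by have [|->] := bBB _ (imageT b k).
pose E k := [set g | b k (act a g x)] `&` [set g | (~` b k) (act a g y)].
have [k nmk] : exists k, ~ meager U (fibre (p x)) (E k).
  apply: contrapT => nk; apply: (open_not_meager hG baseU openT (I : setT (p x)) (src_p x)).
  apply: (@meager_sub _ _ _ _ (\bigcup_k E k)); last first.
    by apply: meager_bigcup => k; apply: contrapT => nmk; apply: nk; exists k.
  move=> g gx _; apply: contrapT => nE; apply: xy.
  rewrite -(act_inv gx) -(@act_inv _ _ _ a g y (etrans gx pxy)); congr act.
  apply: sepBB => A BBA; have [k _ bk] := BBb _ BBA; have [l _ bl] := BBb _ (BBC BBA).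
  split=> [Ax|Ay]; apply: contrapT => nA; apply: nE.
    by exists k => //; rewrite /E bk.
  by exists l => //; rewrite /E bl; split => //=; apply.
have bpE : baire_property U (fibre (p x)) (E k).
  have sa := baire_property_sigma_algebra (fibre (p x)) (open_base_is_base baseU).
  apply: (sigma_algebra_setI sa); first exact: bpBB (bb k).
  by rewrite pxy; apply: bpBB; exact: BBC.
have [n nmn] : exists n, ~ meager U (fibre (p x)) (U n `&` E k).
  apply: contrapT => nn; apply: nmk.
  apply: (@meager_sub _ _ _ _ (\bigcup_n (U n `&` E k))).
    by move=> g _ Eg; have [n [Ung _]] := bU openT (I : setT g); exists n.
  by apply: meager_bigcup => n; apply: contrapT => nmn; apply: nn; exists n.
have [m [[g [gx Umg]] mn mE]] := bpE n nmn.
exists (vaught (b k) (U m)); split; first exact: vaught_open_vaught.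
left; split.
  apply: (vaught_of_comeager hG baseU (oU m) Umg gx).
  by apply; apply: meager_sub mE => h _ [Umh nb]; split => // -[].
apply; rewrite -pxy; apply: meager_sub mE => h _ [Umh bh].
by split => // -[_]; apply.
Qed.

(** [D] collects the points at which [B] is comeager in [U m0], and [U l] is so small that $U_l
    U_l^{-1}$ lies in [U m0]. One arrow of [U l] from $x'$ into [D] thus forbids nonmeagerly many
    arrows of [U l] from $x'$ into the complement of [B]. *)
Lemma vaught_open_regular : regular_opens op.
Proof.
move=> W x oW Wx; have [g [gx gen]] := generic_orbit x.
have [B [n [BBB Ung Bgx BW]]] := vaught_open_nbhs oW Wx gx.
have [m0 [Um0 nv]] := gen B BBB Bgx; rewrite anchor_act// in Um0.
pose D := ~` vaught (~` B) (U m0).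
have BBD : BB D by apply: BBC; apply: BBV; exact: BBC.
have gg : src g = rng (inv g) by rewrite rng_ginv.
have [|A1 [A2 [oA1 oA2 A1g A2g AU]]] := gmul_nbhs hG gg (oU m0).
  by rewrite gmulgV.
have oA2' : open (inv @^-1` A2) by exact: open_ginv hG _ oA2.
have [l [Ulg lA]] := bU (openI (openI oA1 oA2') (oU n)) (conj (conj A1g A2g) Ung).
(* Points whose fibre misses [U l] lie in no transform over [U l]; regularity of the units separates
   them from [x]. *)
have [W' oW' W'E] := src_image hG (oU l).
have W'x : W' (p x) by apply/(W'E _ (unit_p x)); exists g.
have [V1 [V2 [oV1 oV2 V1x V12 V2W]]] := unit_regular hG oW' (unit_p x) W'x.
exists (vaught D (U l) `&` [set x | V1 (p x)]).
exists (vaught (~` B) (U l) `|` [set x | V2 (p x)]); split.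
- by apply: vaught_open_setI; [exact: vaught_open_vaught|exact: vaught_open_anchor].
- rewrite -bigcup2E; apply: vaught_open_bigcup => -[|[|i]] /=.
  + by apply: vaught_open_vaught => //; exact: BBC.
  + exact: vaught_open_anchor.
  + by move=> ? [].
- by split => //; exact: generic_vaught (oU l) Ulg gx.
- move=> x' [vx' V1x'] [vB|]; last exact: V12.
  have [g' [gx' Ulg' Dg']] := vaught_ex vx'.
  apply: Dg'; apply: (@vaught_act _ _ _ hG _ baseU _ a _ (U l) _ (inv g')).
  + by rewrite src_ginv anchor_act.
  + by rewrite act_inv.
  move=> k /lA[[A1k _] _] kg'; apply: AU => //.
  by have [[_]] := lA _ Ulg'.
move=> y /not_orP[nvB nV2].
have [g' Ulg' gy'] := (W'E _ (unit_p y)).1 (V2W _ (unit_p y) nV2).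
have [h [hy Ulh Bh]] := vaught_ex (vaught_of_comeager hG baseU (oU l) Ulg' gy' nvB).
by apply: (BW h y hy) => //; have [] := lA _ Ulh.
Qed.

Lemma vaught_open_separated : separated_opens op.
Proof.
move=> x y /vaught_open_T0[W [oW]].
wlog Wxy : x y / W x /\ ~ W y => [wl|_].
  case=> Wxy; first by apply: (wl x y) => //; left.
  have [V [V' [oV oV' Vy V'x VV']]] := wl y x Wxy (or_introl Wxy).
  exists V', V; split => // z V'z Vz.
  exact: VV' V'z.
have [Wx nWy] := Wxy; have [V [V' [oV oV' Vx VV' V'W]]] := vaught_open_regular oW Wx.
by exists V, V'; split => //; apply: contrapT => /V'W.
Qed.

Lemma vaught_open_base : exists b, open_base op b.
Proof.
have [b [BBb bBB]] := countable_enum set0 cBB.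
have BB0 : BB set0 by rewrite -setCT; exact: BBC.
have bb k : BB (b k) by have [|->] := bBB _ (imageT b k).
exists (fun n => if unpickle n is Some (i, j) then vaught (b i) (U j) else set0).
split=> [n|W x oW Wx].
  by case: unpickle => [[i j]|]; [exact: vaught_open_vaught|move=> ? []].
have [A [j [BBA vA vW]]] := oW x Wx.
have [i _ bi] := BBb _ BBA.
by exists (pickle (i, j)); rewrite pickleK bi.
Qed.

Variable C : set (nat -> set X).
Hypothesis goodBB : good BB C.
Hypothesis localU : forall n, exists r, local_covers (U n) r.

Let Z : Type := (nat * G * X)%type.

(* The first component selects a Polish open piece of [G], which need not be
   Hausdorff globally. *)
Let D : set Z := [set z | [/\ U z.1.1 z.1.2, src z.1.2 = p z.2 &
  generic (act a z.1.2 z.2)]].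

(** The coordinates of a triple [(k, g, x)] that matter are $g$ and $y = g x$; in them, [snd] is the
    map $(g, y) \mapsto g^{-1} y$. *)
Let rectangle (Q : set Z) := exists (W : nat -> set G) (B : nat -> set X),
  (forall k, open (W k) /\ BB (B k)) /\
  forall z, Q z <-> W z.1.1 z.1.2 /\ B z.1.1 (act a z.1.2 z.2).

Let rectangleI (Q Q' : set Z) : rectangle Q -> rectangle Q' -> rectangle (Q `&` Q').
Proof.
move=> [W [B [WB QE]]] [W' [B' [WB' QE']]].
exists (fun k => W k `&` W' k), (fun k => B k `&` B' k); split.
  move=> k; have [oW BBB] := WB k; have [oW' BBB'] := WB' k.
  by split; [exact: openI|exact: BBI].
move=> z; split=> [[Qz Q'z]|[[Wz W'z] [Bz B'z]]].
  by have [? ?] := (QE z).1 Qz; have [? ?] := (QE' z).1 Q'z.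
by split; [exact: (QE z).2|exact: (QE' z).2].
Qed.

Let rectangle_image (Q : set Z) : rectangle Q -> op (snd @` (Q `&` D)).
Proof.
move=> [W [B [WB QE]]].
rewrite (_ : _ @` _ = \bigcup_k vaught (B k) (U k `&` W k)).
  apply: vaught_open_bigcup => k; have [oW BBB] := WB k.
  by apply: vaught_open_vaught => //; exact: openI.
apply/seteqP; split=> [_ [[[k g] x] [/QE/= [Wg Bgx] [/= Ukg gx gen]] <-]|x [k _ vx]].
  have [oW BBB] := WB k.
  by exists k => //; exact: (generic_vaught BBB Bgx gen (openI (oU k) oW)).
have [g [gx [Ukg Wg] Bgx gen]] := generic_ex vx.
by exists (k, g, x) => //; split => //; apply/QE.
Qed.

Let open_rng V : open V -> open (rng @^-1` V).
Proof.
move=> /(open_src hG)/(open_ginv hG); rewrite (_ : _ @^-1` (_ @^-1` V) = rng @^-1` V)//.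
by apply/seteqP; split=> g; rewrite /= src_ginv.
Qed.

Lemma vaught_open_complete : exists r, complete_covers op r.
Proof.
have [_ cC CB Ccov _] := goodBB.
have [e [Ce eC]] := countable_enum (fun=> setT) cC.
have eB i j : BB (e i j) by case: (eC _ (imageT e i)) => [/CB|->].
have ecov i x : exists j, e i j x.
  by case: (eC _ (imageT e i)) => [/Ccov|->]; [exact|exists 0%N].
have [q qU] := choice localU.
(* Three kinds of covers: one fixes the piece, one makes $g$ converge in that piece, one makes $g x$
   converge for [BB]. The implication in the second kind lets it cover triples from other pieces. *)
pose r n j : set Z := if unpickle n is Some t then match t with
  | None => [set z | z.1.1 = j]
  | Some (inl (k, m)) => [set z | z.1.1 = k -> q k m j z.1.2]
  | Some (inr i) => [set z | e i j (act a z.1.2 z.2)]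
  end else setT.
have BB0 : BB set0 by rewrite -setCT; exact: BBC.
have rectT : rectangle setT.
  by exists (fun=> setT), (fun=> setT); split => // k; split => //; exact: openT.
have rectr n j : rectangle (r n j).
  rewrite /r; case: unpickle => [[[[k m]|i]|]|]//.
  - exists (fun k' => if k' == k then q k m j else setT), (fun=> setT); split.
      move=> k'; split => //; case: ifP => _; last exact: openT.
      by have [] := qU k.
    move=> z; case: eqP => [zk|nzk]; split => //=; first by move=> /(_ zk).
    by case.
  - exists (fun=> setT), (fun=> e i j); split => [k|z]; last by split => // -[].
    by split; [exact: openT|].
  - exists (fun k' => if k' == j then setT else set0), (fun=> setT); split.
      by move=> k'; split => //; case: ifP => _; [exact: openT|exact: open0].
    by move=> z; case: eqP => [zj|nzj]; split => // -[].
have branch_rect s : exists2 Q, rectangle Q & branch D r s = Q `&` D.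
  elim: s => [|k s [Q rQ sQ]]; first by exists setT => //; rewrite setTI.
  exists (r (size s) k `&` Q); first exact: rectangleI.
  by rewrite /= sQ setIA.
have [b bop] := vaught_open_base.
have op0 : op set0 by move=> x [].
apply: (@open_image_covers X Z op b vaught_open_setT op0 (@vaught_open_bigcup _) vaught_open_regular bop snd D r) => //.
- move=> n [[k g] x] [/= Ukg gx gen]; rewrite /r.
  case: unpickle => [[[[k' m]|i]|]|].
  + have [kk'|nkk'] := pselect (k = k'); last by exists 0%N.
    have [_ qcov _] := qU k'; have [j qj] := qcov m g (eq_ind k (fun k => U k g) Ukg k' kk').
    by exists j.
  + exact: ecov.
  + by exists k.
  + by exists 0%N.
- move=> x; have [g [gx gen]] := generic_orbit x.
  have [n [Ung _]] := bU openT (I : setT g).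
  by exists (n, g, x).
- by move=> s; have [Q rQ ->] := branch_rect s; exact: rectangle_image.
move=> F FU FD Fr.
have [k Fk] := Fr (pickle (None : option (nat * nat + nat))); rewrite /r pickleK in Fk.
pose Fg := [set A : set G | F [set z | A z.1.2]].
have FgU : UltraFilter Fg by exact: (@ultra_comap _ F FU _ (fun z : Z => z.1.2)).
pose Fy := [set A : set X | F [set z | A (act a z.1.2 z.2)]].
have FyU : UltraFilter Fy by exact: (@ultra_comap _ F FU _ (fun z : Z => act a z.1.2 z.2)).
have [_ _ qlim] := qU k.
have FUk : F [set z | U k z.1.2].
  by apply: filterS (filterI FD Fk) => z [[Uz _ _] /= <-].
have Fq m : exists j, F [set z | q k m j z.1.2].
  have [j Fj] := Fr (pickle (Some (inl (k, m)) : option (nat * nat + nat))).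
  exists j; rewrite /r pickleK in Fj.
  by apply: filterS (filterI Fk Fj) => z [/= zk]; apply.
have [g [Ukg Fgg]] := qlim Fg FgU FUk Fq.
have [|y Fyy] := good_limit goodBB FyU.
  move=> c /Ce[i _ <-].
  have [j Fj] := Fr (pickle (Some (inr i) : option (nat * nat + nat))).
  by exists j; rewrite /r pickleK in Fj.
(* The limits of $g$ and of $g x$ are found separately. They match because the units are Hausdorff
   and [BBp] makes the anchor continuous for [BB]. *)
have gy : rng g = p y.
  apply: contrapT => /(unit_separated hG (@unit_rng _ gpd g) (unit_p y)).
  move=> [V [V' [oV oV' Vg V'y VV']]].
  have FV : F [set z | V (rng z.1.2)] by exact: (Fgg _ (open_rng oV) Vg).
  have [n [Uny nV']] := bU oV' V'y.
  have FV' : F [set z | U n (p (act a z.1.2 z.2))].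
    exact: (Fyy _ (BBp n)).2 Uny.
  have [z [[Vz Unz] [_ zx _]]] := filter_ex (filterI (filterI FV FV') FD).
  rewrite /= anchor_act// in Unz.
  exact: (VV' _ (@unit_rng _ gpd _) Vz (nV' _ Unz)).
have gx : src (inv g) = p y by rewrite src_ginv.
exists (act a (inv g) y) => W oW Wx.
have gx' : src g = p (act a (inv g) y) by rewrite anchor_act// rng_ginv.
have [B [n [BBB Ung Bgx BW]]] := vaught_open_nbhs oW Wx gx'.
have gyy : act a g (act a (inv g) y) = y by have := act_inv gx; rewrite ginvK.
rewrite gyy in Bgx.
have FUn : F [set z | U n z.1.2] by exact: (Fgg _ (oU n) Ung).
have FB : F [set z | B (act a z.1.2 z.2)] by exact: (Fyy _ BBB).2 Bgx.
suff : F (snd @^-1` W) by [].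
by apply: filterS (filterI (filterI FUn FB) FD) => z [[Unz Bz] [_ zx _]]; exact: BW zx _ _.
Qed.

Lemma vaught_open_polish : polish_opens op.
Proof.
by split; [exact: vaught_open_separated|exact: vaught_open_regular|exact: vaught_open_base|exact: vaught_open_complete].
Qed.

End vaught_topology.

(** * Borel sets of the new topology *)

Section separation.
Context {X : Type} (op : set (set X)).

Definition borel_separable (P Q : set X) :=
  exists E, [/\ <<s op >> E, P `<=` E & Q `<=` ~` E].

Lemma borel_separable_bigcup (P Q : nat -> set X) :
  (forall i j, borel_separable (P i) (Q j)) ->
  borel_separable (\bigcup_i P i) (\bigcup_j Q j).
Proof.
move=> sep; have /choice[E EP] : forall ij : nat * nat, exists E,
  [/\ <<s op >> E, P ij.1 `<=` E & Q ij.2 `<=` ~` E] by case=> i j; exact: sep.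
exists (\bigcup_i (setT `\` \bigcup_j (setT `\` E (i, j)))); split.
- apply: sigma_algebra_bigcup => i; apply: sigma_algebraCD.
  apply: sigma_algebra_bigcup => j; apply: sigma_algebraCD.
  by have [] := EP (i, j).
- move=> x [i _ Pix]; exists i => //; split => // -[j _ []] _; apply.
  by have [_ + _] := EP (i, j); apply.
- move=> x [j _ Qjx] [i _ [_]]; apply; exists j => //; split => //.
  by have [_ _] := EP (i, j); apply.
Qed.

(* Lusin's separation argument: two inseparable sets shrink to inseparable
   neighbourhoods of two distinct points. *)
Lemma good_borel (BB : set (set X)) (C : set (nat -> set X)) :
  good BB C -> (forall A, BB A -> BB (~` A)) -> separated_opens op ->
  (forall W x, op W -> W x -> exists A, [/\ BB A, A x & A `<=` W]) ->
  BB `<=` <<s op >>.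
Proof.
move=> gBB BBC sepop opBB A BBA; apply: contrapT => nA.
have [cBB cC _ Ccov _] := gBB.
have [e [Ce eC]] := countable_enum (fun=> setT) cC.
have [b [BBb _]] := countable_enum set0 cBB.
have ecov n x : exists j, e n j x.
  by case: (eC _ (imageT e n)) => [/Ccov|->]; [exact|exists 0%N].
(* Even rows force convergence through the covers in [C]; odd rows decide membership in each
   [b n]. *)
pose r n j : set X :=
  if odd n then (if j is 0%N then b n./2 else ~` b n./2) else e n./2 j.
have rcov n x : exists j, r n j x.
  rewrite /r; case: odd; last exact: ecov.
  by have [bx|nbx] := pselect (b n./2 x); [exists 0%N|exists 1%N].
have rsplit n (P : set X) : P = \bigcup_j (P `&` r n j).
  apply/seteqP; split=> [x Px|x [j _ []//]].
  by have [j rx] := rcov n x; exists j.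
have /choice[nxt nxtP] : forall nPQ : nat * (set X * set X), exists ij : nat * nat,
    ~ borel_separable nPQ.2.1 nPQ.2.2 ->
    ~ borel_separable (nPQ.2.1 `&` r nPQ.1 ij.1) (nPQ.2.2 `&` r nPQ.1 ij.2).
  move=> [n [P Q]] /=; apply: contrapT => nij.
  have sep i j : borel_separable (P `&` r n i) (Q `&` r n j).
    by apply: contrapT => nsep; apply: nij; exists (i, j).
  apply: nij; exists (0%N, 0%N); case.
  by rewrite (rsplit n P) (rsplit n Q); exact: borel_separable_bigcup.
pose st n := iteri n (fun n PQ => let ij := nxt (n, PQ) in
  (PQ.1 `&` r n ij.1, PQ.2 `&` r n ij.2)) (A, ~` A).
have stn n : ~ borel_separable (st n).1 (st n).2.
  elim: n => [[E [sE AE nAE]]|n IH]; last exact: (nxtP (n, st n)) IH.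
  apply: nA; suff -> : A = E by [].
  by apply/seteqP; split => // x Ex; apply: contrapT => /nAE.
have limit (Q : nat -> set X) (j : nat -> nat) :
    (forall n, Q n !=set0) -> (forall n, Q n.+1 = Q n `&` r n (j n)) ->
    exists x, (forall B, BB B -> B x -> exists n, Q n `<=` B) /\
      (BB (Q 0%N) -> Q 0%N x).
  move=> Q0 QS.
  have Qmono m n : (m <= n)%N -> Q n `<=` Q m.
    move=> /subnK <-; elim: (n - m)%N => // k IH.
    by rewrite addSn QS => x [/IH].
  have pF : ProperFilter (filter_from setT Q).
    apply: filter_from_proper => [|n _]; last exact: Q0.
    apply: filter_from_filter; first by exists 0%N.
    move=> m n _ _; exists (maxn m n) => // x Qx.
    by split; [exact: (Qmono _ _ (leq_maxl m n))|exact: (Qmono _ _ (leq_maxr m n))].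
  have [F [FU QF]] := ultraFilterLemma pF.
  have FQ n : F (Q n) by apply: QF; exists n.
  have [|x Fx] := good_limit gBB FU.
    move=> c /Ce[n _ <-]; exists (j n.*2); apply: filterS (FQ n.*2.+1) => x.
    by rewrite QS /r odd_double doubleK => -[].
  exists x; split=> [B BBB Bx|BBQ]; last exact/(Fx _ BBQ).
  (* Row [n.*2.+1] decides [b n], and stage [n.*2.+2] is the first to include it. *)
  have [n _ bn] := BBb _ BBB; exists n.*2.+2.
  have := FQ n.*2.+2; rewrite QS /r /= odd_double /= uphalf_double bn.
  case: (j n.*2.+1) => [|k] FQB; first by move=> y [].
  have FB := (Fx _ BBB).2 Bx.
  by case: (ultra_not FB FQB) => y By [_ nBy]; exact: nBy.
have [|n|x [xP Ax]] := limit (fun n => (st n).1) (fun n => (nxt (n, st n)).1).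
- move=> n; apply: contrapT => n0; apply: (stn n); exists set0; split.
  + exact: sigma_algebra0.
  + by move=> x Px; apply: n0; exists x.
  + by move=> x _ [].
- by [].
have [|n|y [yQ nAy]] := limit (fun n => (st n).2) (fun n => (nxt (n, st n)).2).
- move=> n; apply: contrapT => n0; apply: (stn n); exists setT; split => //.
  + by have [s0 sC _] := smallest_sigma_algebra setT op; have := sC _ s0; rewrite setD0.
  + by move=> x' Qx; case: n0; exists x'.
- by [].
have xy : x <> y.
  by move=> xy; apply: (nAy (BBC _ BBA)); rewrite -xy; exact: Ax.
have [W [W' [oW oW' Wx W'y WW']]] := sepop _ _ xy.
have [B [BBB Bx BW]] := opBB _ _ oW Wx; have [B' [BBB' B'y BW']] := opBB _ _ oW' W'y.
have [n nB] := xP B BBB Bx; have [m mB] := yQ B' BBB' B'y.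
have mono i k : (i <= k)%N -> (st k).1 `<=` (st i).1 /\ (st k).2 `<=` (st i).2.
  move=> /subnK <-; elim: (k - i)%N => [|l [IH1 IH2]]; first by split.
  by split=> z [/=]; [move=> /IH1|move=> /IH2].
have [s1 _] := mono _ _ (leq_maxl n m); have [_ s2] := mono _ _ (leq_maxr n m).
apply: (stn (maxn n m)); exists W; split.
- exact: sub_sigma_algebra.
- by move=> z /s1/nB/BW.
- by move=> z /s2/mB/BW' W'z /WW'.
Qed.

End separation.

(** * A topology from its family of open sets, and the conclusion *)

Section topology_of_opens.
Context {X : Type} (op : set (set X)).
Hypotheses (opT : op setT) (opI : setI_closed op).
Hypothesis opU : forall (I : Type) (f : I -> set X),
  (forall i, op (f i)) -> op (\bigcup_i f i).

Definition space_of_opens of op setT & setI_closed op & (forall (I : Type)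
  (f : I -> set X), (forall i, op (f i)) -> op (\bigcup_i f i)) : Type := X.
Local Notation T := (space_of_opens opT opI opU).

HB.instance Definition _ := gen_eqMixin T.
HB.instance Definition _ := gen_choiceMixin T.
HB.instance Definition _ := isOpenTopological.Build T opT opI opU.

Lemma topology_of_opens :
  exists t : Topological X, @open (Topological.Pack t) = op.
Proof. by exists (Topological.class T). Qed.

End topology_of_opens.

Theorem theorem4p1 (R : realType) (G : topologicalType) (gpd : groupoid G)
    (hG : polish_groupoid R gpd)
    (X : Type) (S : set (set X)) (aX : gspace gpd X)
    (hX : borel_gspace R S aX) :
  (exists (Y : topologicalType) (aY : gspace gpd Y) (phi : X -> Y),
     polish_gspace R aY /\ borel_gisomorphism S (borel Y) aX aY phi) /\
  (exists t : Topological X,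
     let XT : topologicalType := Topological.Pack t in
     borel XT = S /\ @polish_gspace R G gpd XT aX).
Proof.
suff [t [bt pt]] : exists t : Topological X,
     let XT : topologicalType := Topological.Pack t in
     borel XT = S /\ @polish_gspace R G gpd XT aX.
  split; last by exists t.
  exists (Topological.Pack t), aX, id; split => //; split => //.
    by exists id.
  by rewrite bt.
have [U [baseU localU]] := groupoid_base hG.
have [[tS [/polishP polS bS]] _ _] := hX.
have [B0 [C0 [g0 sep0 sB0]]] := good_polish_opens polS.
have SB0 : S = <<s B0 >> by rewrite sB0 -bS.
have salgS : sigma_algebra setT S by rewrite SB0; exact: smallest_sigma_algebra.
have [S0 SC _] := salgS.
(* One binary family codes all closure operations: complement and transforms ignore [A']. *)
pose ops (n : nat) (A A' : set X) : set X :=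
  match n with 0 => ~` A | 1 => A `&` A' | n.+2 => vaught U aX A (U n) end.
(* The preimages of the [U n] make the anchor continuous for the topology of [BB], as matching the
   two limits in the completeness proof requires. *)
pose init (n : nat) : set X :=
  if n is n.+1 then [set x | U n (set_val (anchor aX x))] else setT.
have [||BB [C [gBB B0BB BBS BBinit BBops]]] :=
    good_closure (op := ops) (init := init) g0 sep0; rewrite -?SB0.
- move=> [|n] /=; first by rewrite -setC0 -setTD; exact: SC.
  have [_ anchorS _] := hX.
  apply: (anchorS (set_val @^-1` U n)); apply: sub_sigma_algebra.
  by apply/open_set_typeP; exists (U n) => //; exact: baseU.1.
- move=> [|[|n]] A A' SA SA' /=.
  + by rewrite -setTD; exact: SC.
  + exact: sigma_algebra_setI.
  + by have [+ _] := action_category hG baseU hX salgS SA; apply.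
rewrite -SB0 in BBS.
have cBB : countable BB by have [] := gBB.
have sepBB : separates_points BB.
  by move=> x y xy; apply: sep0 => A /B0BB; exact: xy.
have BBT : BB setT := BBinit 0%N.
have BBp n : BB [set x | U n (set_val (anchor aX x))] := BBinit n.+1.
have BBC A : BB A -> BB (~` A) by move=> BBA; exact: (BBops 0%N A A).
have BBI : setI_closed BB by move=> A A'; exact: (BBops 1%N A A').
have BBV A n : BB A -> BB (vaught U aX A (U n)).
  by move=> BBA; exact: (BBops n.+2 A A).
pose op := vaught_open_set U aX BB.
have opT : op setT by exact: (vaught_open_setT hG baseU hX salgS).
have opI : setI_closed op by exact: (vaught_open_setI hG baseU hX salgS).
have opU I (f : I -> set X) : (forall i, op (f i)) -> op (\bigcup_i f i).
  exact: vaught_open_bigcup.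
have [t topE] := topology_of_opens opT opI opU.
have pol : polish_opens op.
  exact: (vaught_open_polish hG baseU hX salgS BBS cBB sepBB BBT BBC BBI BBV BBp gBB localU).
have opBB W x : op W -> W x -> exists A, [/\ BB A, A x & A `<=` W].
  move=> oW Wx; have [A [n [BBA vA vW]]] := oW x Wx.
  by exists (vaught U aX A (U n)); split => //; exact: BBV.
exists t; split.
  rewrite /borel topE; apply/seteqP; split.
    apply: smallest_sub => // W oW.
    have [e [BBe eBB]] := countable_enum set0 cBB.
    rewrite (_ : W = \bigcup_k [set x | e k x /\ e k `<=` W]).
      have [_ _ SU] := salgS; apply: SU => k.
      have [ekW|nekW] := pselect (e k `<=` W).
        rewrite (_ : [set _ | _] = e k); last by apply/seteqP; split => x // [].
        by have [/BBS|->] := eBB _ (imageT e k).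
      by rewrite (_ : [set _ | _] = set0)//; apply/seteqP; split => x // [].
    apply/seteqP; split=> [x Wx|x [k _ [ekx]]]; last exact.
    have [A [BBA Ax AW]] := opBB _ _ oW Wx; have [k _ ek] := BBe _ BBA.
    by exists k => //=; rewrite ek.
  rewrite SB0; apply: smallest_sub; first exact: smallest_sigma_algebra.
  apply: subset_trans B0BB _; apply: (good_borel gBB BBC) => //.
  by have [] := pol.
split.
- by apply/polishP; rewrite topE.
- apply/continuousP => V /open_set_typeP[W oW VW]; rewrite topE.
  rewrite (_ : _ @^-1` V = [set x | W (set_val (anchor aX x))]).
    exact: (vaught_open_anchor hG baseU hX salgS).
  by apply/seteqP; split => x /VW.
apply/continuousP => W; rewrite topE => oW.
apply/open_set_typeP; exists [set z | exists V W', [/\ open V, op W', V z.1, W' z.2 &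
  forall h x, V h -> W' x -> src gpd h = set_val (anchor aX x) -> W (act aX h x)]].
  apply/open_prodP => h x [V [W' [oV oW' Vh W'x VW]]].
  exists V, W'; split => //; first by rewrite topE.
  by move=> h' x' Vh' W'x'; exists V, W'.
move=> z; have hz : src gpd (set_val z).1 = set_val (anchor aX (set_val z).2).
  exact: (set_valP z).
split=> [Wz|[V [W' [_ _ Vz W'z VW]]]]; last exact: VW.
exact: (vaught_open_act hG baseU hX salgS BBS cBB BBT BBC BBV oW hz Wz).
Qed.
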